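(* Let $\pi : Y \to X$ be a finite surjective morphism of normal $F$-finite algebraic varieties of characteristic $p>0$. Assume that $\pi$ is separable (i.e. the induced extension of function fields is separable) and tamely ramified in codimension one. Let $e > 0$ be an integer and let $\psi \in \operatorname{Hom}_{\mathcal{O}_X}(F^e_*\mathcal{O}_X, \mathcal{O}_X)$ be nonzero. Then $\psi$ extends to a homomorphism $\bar\psi \in \operatorname{Hom}_{\mathcal{O}_Y}(F^e_*\mathcal{O}_Y, \mathcal{O}_Y)$ if and only if $\pi^*\Delta_\psi \geq \operatorname{Ram}_\pi$. Furthermore, in this case, $\Delta_{\bar\psi} = \pi^*\Delta_\psi - \operatorname{Ram}_\pi$.
   Context: Varieties are integral schemes of finite type over an $F$-finite field of characteristic $p>0$ (a field $k$ is $F$-finite if $[k:k^p]<\infty$). $F^e$ denotes the $e$-iterated absolute Frobenius. Extension: $\bar\psi$ extends $\psi$ if it restricts to $\psi$ along $\mathcal{O}_X \subseteq \pi_*\mathcal{O}_Y$, i.e. the composite $F^e_*\mathcal{O}_X \to \pi_*F^e_*\mathcal{O}_Y \xrightarrow{\pi_*\bar\psi} \pi_*\mathcal{O}_Y$ equals the composite of $\psi$ with the inclusion $\mathcal{O}_X \to \pi_*\mathcal{O}_Y$. Affine-locally, with $X=\operatorname{Spec} R$, $Y=\operatorname{Spec} S$, $F^e_*R = R^{1/p^e}$ and $F^e_*S = S^{1/p^e}$, this means $\bar\psi|_{R^{1/p^e}} = \psi$. The divisor $\Delta_\psi$: on a normal variety $X$, $\mathcal{H}om_{\mathcal{O}_X}(F^e_*\mathcal{O}_X,\mathcal{O}_X)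 \cong F^e_*\mathcal{O}_X((1-p^e)K_X)$, so a nonzero $\psi$ corresponds to an effective Weil divisor $D_\psi$ linearly equivalent to $(1-p^e)K_X$. Concretely, for each codimension one point $\mathfrak{p}$, with $R=\mathcal{O}_{X,\mathfrak{p}}$ a DVR, $\operatorname{Hom}_R(R^{1/p^e},R)$ is a free $R^{1/p^e}$-module of rank one; if $\Phi$ is a generator and $\psi(\,\cdot\,) = \Phi(c^{1/p^e}\cdot\,)$ with $c\in R$, then the coefficient of $D_\psi$ along the prime divisor $\overline{\{\mathfrak{p}\}}$ is the valuation of $c$ in $R$. One sets $\Delta_\psi = \frac{1}{p^e-1} D_\psi$, an effective $\mathbb{Q}$-divisor. Pullback $\pi^*$ of Weil ($\mathbb{Q}$-)divisors under the finite surjective morphism $\pi$ of normal varieties is defined by pulling back local equations at codimension one points. Tame ramification: a local inclusion of DVRs $(R,\mathfrak{p})\subseteq(S,\mathfrak{q})$ is tamely ramified if (1) it is generically finite and generically separable (i.e. $\operatorname{Frac}R \subseteq \operatorname{Frac}S$ is finite separable), (2) the residue field extension $k(\mathfrak{p})\subseteq k(\mathfrak{q})$ is separable, and (3) the order of vanishing in $S$ of a local parameter $r$ of $R$ (the ramification index) is not divisible by $p$. $\pi$ is tamely ramified in codimension one if for every codimension one point $\mathfrak{q}$ of $Y$, with image $\mathfrak{p} = \pi(\mathfrak{q})$, the inclusion $\mathcal{O}_{X,\mathfrak{p}} \subseteq \mathcal{O}_{Y,\mathfrak{q}}$ is tamely ramified. In this case the ramification divisor is $\operatorname{Ram}_\pi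 = \sum_{Q} (n_Q - 1) Q$, the sum over prime divisors $Q$ of $Y$, where $n_Q$ is the ramification index of the DVR extension at the generic point of $Q$. *)

(* Defs.v *)
From HB Require Import structures.
From mathcomp Require Import all_boot all_order all_algebra all_field.
From mathcomp Require Import boolp classical_sets topology_structure.

Set Implicit Arguments.
Unset Strict Implicit.
Unset Printing Implicit Defensive.
Import Order.TTheory GRing.Theory Num.Theory.
Local Open Scope classical_set_scope.
Local Open Scope ring_scope.
Local Open Scope quotient_scope.

Record opens (T : topologicalType) := Opens { oset :> set T; _ : open oset }.

Lemma opens_open (T : topologicalType) (U : opens T) : open (U : set T).
Proof. by case: U. Qed.

Definition oI (T : topologicalType) (U V : opens T) : opens T :=
  Opens (openI (opens_open U) (opens_open V)).

Lemma oIl (T : topologicalType) (U V : opens T) : oI U V `<=` U.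
Proof. by move=> z []. Qed.

Lemma oIr (T : topologicalType) (U V : opens T) : oI U V `<=` V.
Proof. by move=> z []. Qed.

Definition oT (T : topologicalType) : opens T := Opens (@openT T).

Lemma sub_oT (T : topologicalType) (U : opens T) : U `<=` oT T.
Proof. by []. Qed.

Arguments sub_oT {T} U [t] _.

(* Rings may be zero, as O(set0) is.  The axiom rs_glue packs together the two
   sheaf conditions: separation (uniqueness of t) and gluing (existence). *)
Record ringedSpace := RingedSpace {
  rs_pt :> topologicalType;
  sect : opens rs_pt -> comPzRingType;
  res : forall U V : opens rs_pt, V `<=` U -> {rmorphism sect U -> sect V};
  rs_res_id : forall (U : opens rs_pt) (h : U `<=` U) (s : sect U),
    res h s = s;
  rs_res_comp : forall (U V W : opens rs_pt) (h : V `<=` U) (h' : W `<=` V)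
    (h'' : W `<=` U) (s : sect U), res h' (res h s) = res h'' s;
  rs_glue : forall (U : opens rs_pt) (I : Type) (V : I -> opens rs_pt)
    (h : forall i, V i `<=` U), U `<=` \bigcup_i V i ->
    forall s : forall i, sect (V i),
    (forall i j (W : opens rs_pt) (hi : W `<=` V i) (hj : W `<=` V j),
       res hi (s i) = res hj (s j)) ->
    exists! t : sect U, forall i, res (h i) t = s i
}.

Section Stalk.
Variables (X : ringedSpace) (x : X).

Record pregerm := Pregerm {
  pg_dom : opens X;
  pg_in : oset pg_dom x;
  pg_sect : sect pg_dom
}.

HB.instance Definition _ := gen_eqMixin pregerm.
HB.instance Definition _ := gen_choiceMixin pregerm.

Definition pregerm_equiv (a b : pregerm) : bool :=
  `[< exists W : opens X, oset W x /\
      exists (ha : W `<=` pg_dom a) (hb : W `<=` pg_dom b),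
        res ha (pg_sect a) = res hb (pg_sect b) >].

Lemma res_irr (U V : opens X) (h h' : V `<=` U) (s : sect U) :
  res h s = res h' s.
Proof. by rewrite (Prop_irrelevance h h'). Qed.

Lemma pregerm_equivP : equiv_class_of pregerm_equiv.
Proof.
split.
- move=> a; apply/asboolP; exists (pg_dom a); split; first exact: pg_in.
  by exists (@subset_refl _ _), (@subset_refl _ _).
- move=> a b; apply/idP/idP => /asboolP[W [Wx [ha [hb e]]]]; apply/asboolP;
    by exists W; split=> //; exists hb, ha.
- move=> b a c /asboolP[W [Wx [ha [hb e]]]] /asboolP[W' [W'x [hb' [hc e']]]].
  apply/asboolP; exists (oI W W'); split=> //.
  have i1 : oI W W' `<=` W by move=> z [].
  have i2 : oI W W' `<=` W' by move=> z [].
  exists (subset_trans i1 ha), (subset_trans i2 hc).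
  rewrite -(rs_res_comp ha i1) -(rs_res_comp hc i2) e -e'.
  rewrite (rs_res_comp hb i1 (subset_trans i1 hb)).
  by rewrite (rs_res_comp hb' i2 (subset_trans i1 hb)).
Qed.

Canonical pregerm_equivRel := EquivRelPack pregerm_equivP.

Definition stalk := {eq_quot pregerm_equiv}.

HB.instance Definition _ := Choice.on stalk.
HB.instance Definition _ : EqQuotient pregerm pregerm_equiv stalk :=
  EqQuotient.on stalk.

Definition germ (U : opens X) (hx : oset U x) (s : sect U) : stalk :=
  \pi_stalk (Pregerm hx s).

Lemma germP (a b : pregerm) :
  (exists W : opens X, oset W x /\ exists (ha : W `<=` pg_dom a)
     (hb : W `<=` pg_dom b), res ha (pg_sect a) = res hb (pg_sect b)) ->
  \pi_stalk a = \pi_stalk b.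
Proof. by move=> h; apply/eqmodP/asboolP. Qed.

Lemma germ_eq (U V : opens X) (hU : oset U x) (hV : oset V x) (s : sect U) (t : sect V) :
  germ hU s = germ hV t -> exists W : opens X, oset W x /\
    exists (h : W `<=` U) (h' : W `<=` V), res h s = res h' t.
Proof. by move/eqmodP/asboolP. Qed.

Lemma germ_res (U V : opens X) (h : V `<=` U) (hU : oset U x) (hV : oset V x)
  (s : sect U) : germ hV (res h s) = germ hU s.
Proof.
apply: germP => /=; exists V; split=> //; exists (@subset_refl _ _), h.
by rewrite rs_res_id.
Qed.

Lemma germ_ex (g : stalk) : exists (U : opens X) (hU : oset U x) (s : sect U),
  g = germ hU s.
Proof.
by exists (pg_dom (repr g)), (pg_in (repr g)), (pg_sect (repr g));
  rewrite /germ -[LHS]reprK; case: (repr g).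
Qed.

Definition pregerm_op (op : forall U : opens X, sect U -> sect U -> sect U)
  (a b : pregerm) : pregerm :=
  @Pregerm (oI (pg_dom a) (pg_dom b)) (conj (pg_in a) (pg_in b))
    (op _ (res (@oIl _ _ _) (pg_sect a))
          (res (@oIr _ _ _) (pg_sect b))).

Definition stalk_zero : stalk := @germ (oT X) I 0.
Definition stalk_one : stalk := @germ (oT X) I 1.
Definition stalk_opp (g : stalk) : stalk :=
  germ (pg_in (repr g)) (- pg_sect (repr g)).
Definition stalk_add (g h : stalk) : stalk :=
  \pi_stalk (pregerm_op (fun U (s t : sect U) => s + t) (repr g) (repr h)).
Definition stalk_mul (g h : stalk) : stalk :=
  \pi_stalk (pregerm_op (fun U (s t : sect U) => s * t) (repr g) (repr h)).

Lemma stalk_oppE (U : opens X) (hU : oset U x) (s : sect U) :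
  stalk_opp (germ hU s) = germ hU (- s).
Proof.
rewrite /stalk_opp; set r := repr _.
have : germ (pg_in r) (pg_sect r) = germ hU s.
  by rewrite -[RHS]reprK -/r /germ; case: (r).
move=> /germ_eq[W [Wx [h [h' e]]]]; apply: germP => /=.
by exists W; split=> //; exists h, h'; rewrite !rmorphN e.
Qed.

Lemma stalk_opE (op : forall U : opens X, sect U -> sect U -> sect U) :
  (forall (U V : opens X) (h : V `<=` U) s t,
     res h (op U s t) = op V (res h s) (res h t)) ->
  forall (U : opens X) (hU : oset U x) (s t : sect U),
  \pi_stalk (pregerm_op op (repr (germ hU s)) (repr (germ hU t))) =
  germ hU (op U s t).
Proof.
move=> opM U hU s t; set r := repr _; set r' := repr (germ hU t).
have : germ (pg_in r) (pg_sect r) = germ hU s.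
  by rewrite -[RHS]reprK -/r /germ; case: (r).
move=> /germ_eq[W [Wx [h1 [h2 e]]]].
have : germ (pg_in r') (pg_sect r') = germ hU t.
  by rewrite -[RHS]reprK -/r' /germ; case: (r').
move=> /germ_eq[W' [W'x [h1' [h2' e']]]].
have i1 : oI W W' `<=` W by move=> z [].
have i2 : oI W W' `<=` W' by move=> z [].
apply: germP => /=; exists (oI W W'); split=> //.
have hd : oI W W' `<=` oI (pg_dom r) (pg_dom r').
  by move=> z [z1 z2]; split; [exact (h1 z z1)|exact (h1' z z2)].
exists hd, (subset_trans i1 h2); rewrite !opM.
rewrite (rs_res_comp _ _ (subset_trans i1 h1)).
rewrite (rs_res_comp _ _ (subset_trans i2 h1')).
rewrite -(rs_res_comp h1 i1) -(rs_res_comp h1' i2) e e'.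
rewrite (rs_res_comp _ _ (subset_trans i1 h2)).
by rewrite (rs_res_comp _ _ (subset_trans i1 h2)).
Qed.

Lemma stalk_addE (U : opens X) (hU : oset U x) (s t : sect U) :
  stalk_add (germ hU s) (germ hU t) = germ hU (s + t).
Proof. by apply: stalk_opE => *; rewrite rmorphD. Qed.

Lemma stalk_mulE (U : opens X) (hU : oset U x) (s t : sect U) :
  stalk_mul (germ hU s) (germ hU t) = germ hU (s * t).
Proof. by apply: stalk_opE => *; rewrite rmorphM. Qed.

Lemma germ_ex2 (g h : stalk) : exists (U : opens X) (hU : oset U x) (s t : sect U),
  g = germ hU s /\ h = germ hU t.
Proof.
have [U [hU [s ->]]] := germ_ex g; have [V [hV [t ->]]] := germ_ex h.
have hx : oset (oI U V) x by [].
exists (oI U V), hx, (res (@oIl _ U V) s), (res (@oIr _ U V) t).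
by rewrite (germ_res _ hU) (germ_res _ hV).
Qed.

Lemma germ_ex3 (g h k : stalk) :
  exists (U : opens X) (hU : oset U x) (s t u : sect U),
  [/\ g = germ hU s, h = germ hU t & k = germ hU u].
Proof.
have [U [hU [s [t [-> ->]]]]] := germ_ex2 g h.
have [V [hV [u ->]]] := germ_ex k; have hx : oset (oI U V) x by [].
exists (oI U V), hx, (res (@oIl _ U V) s), (res (@oIl _ U V) t).
by exists (res (@oIr _ U V) u); rewrite !(germ_res _ hU) (germ_res _ hV).
Qed.

Lemma stalk_zeroE (U : opens X) (hU : oset U x) : stalk_zero = germ hU 0.
Proof. by rewrite /stalk_zero -(@germ_res (oT X) U (sub_oT U) I hU) rmorph0. Qed.

Lemma stalk_oneE (U : opens X) (hU : oset U x) : stalk_one = germ hU 1.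
Proof. by rewrite /stalk_one -(@germ_res (oT X) U (sub_oT U) I hU) rmorph1. Qed.

Lemma stalk_addA : associative stalk_add.
Proof.
move=> a b c; have [U [hU [s [t [u [-> -> ->]]]]]] := germ_ex3 a b c.
by rewrite !stalk_addE addrA.
Qed.

Lemma stalk_addC : commutative stalk_add.
Proof.
move=> a b; have [U [hU [s [t [-> ->]]]]] := germ_ex2 a b.
by rewrite !stalk_addE addrC.
Qed.

Lemma stalk_add0 : left_id stalk_zero stalk_add.
Proof.
move=> a; have [U [hU [s ->]]] := germ_ex a.
by rewrite (stalk_zeroE hU) stalk_addE add0r.
Qed.

Lemma stalk_addN : left_inverse stalk_zero stalk_opp stalk_add.
Proof.
move=> a; have [U [hU [s ->]]] := germ_ex a.
by rewrite (stalk_zeroE hU) stalk_oppE stalk_addE addNr.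
Qed.

Lemma stalk_mulA : associative stalk_mul.
Proof.
move=> a b c; have [U [hU [s [t [u [-> -> ->]]]]]] := germ_ex3 a b c.
by rewrite !stalk_mulE mulrA.
Qed.

Lemma stalk_mulC : commutative stalk_mul.
Proof.
move=> a b; have [U [hU [s [t [-> ->]]]]] := germ_ex2 a b.
by rewrite !stalk_mulE mulrC.
Qed.

Lemma stalk_mul1 : left_id stalk_one stalk_mul.
Proof.
move=> a; have [U [hU [s ->]]] := germ_ex a.
by rewrite (stalk_oneE hU) stalk_mulE mul1r.
Qed.

Lemma stalk_mulD : left_distributive stalk_mul stalk_add.
Proof.
move=> a b c; have [U [hU [s [t [u [-> -> ->]]]]]] := germ_ex3 a b c.
by rewrite !(stalk_mulE, stalk_addE) mulrDl.
Qed.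

HB.instance Definition _ := GRing.isZmodule.Build stalk
  stalk_addA stalk_addC stalk_add0 stalk_addN.
HB.instance Definition _ := GRing.Zmodule_isComPzRing.Build stalk
  stalk_mulA stalk_mulC stalk_mul1 stalk_mulD.

End Stalk.

Definition invertible (A : comPzRingType) (a : A) : Prop :=
  exists b, b * a = 1.

Definition local_ring (A : comPzRingType) : Prop :=
  (1 : A) <> 0 /\
  forall a b : A, ~ invertible a -> ~ invertible b -> ~ invertible (a + b).

Definition prime_ideal (A : comPzRingType) (P : set A) : Prop :=
  [/\ P 0, (forall a b, P a -> P b -> P (a + b)),
      (forall a b, P b -> P (a * b)), ~ P 1 &
      forall a b, P (a * b) -> P a \/ P b].

(* phi : A -> B exhibits B as the localization A_f. *)
Definition is_localization (A B : comPzRingType) (f : A) (phi : A -> B) : Prop :=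
  [/\ invertible (phi f),
      (forall b, exists a n, phi f ^+ n * b = phi a) &
      forall a, phi a = 0 -> exists n, f ^+ n * a = 0].

Definition basic_set (X : ringedSpace) (U : opens X) (f : sect U) : set X :=
  [set x | exists hx : oset U x, invertible (germ hx f)].

Lemma basic_set_open (X : ringedSpace) (U : opens X) (f : sect U) :
  open (basic_set f).
Proof.
rewrite openE => x [hx [g]]; have [V [hV [t ->]]] := germ_ex g.
have hUV : oset (oI V U) x by [].
have iV : oI V U `<=` V by move=> z [].
have iU : oI V U `<=` U by move=> z [].
rewrite -(germ_res iV hV hUV) -(germ_res iU hx hUV).
rewrite [_ * _](stalk_mulE hUV) [1](stalk_oneE hUV).
move=> /germ_eq[W [Wx [h [h' e]]]].
rewrite /interior nbhsE; exists (W : set X); first by split => //; exact: opens_open.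
move=> y Wy; have [hyV hyU] := h _ Wy; exists hyU, (germ hyV t).
have hy : oset (oI V U) y by [].
rewrite -(germ_res iV hyV hy) -(germ_res iU hyU hy).
rewrite [_ * _](stalk_mulE hy) [1](stalk_oneE hy).
by rewrite -(germ_res h hy Wy) e (germ_res h' hy Wy).
Qed.

Definition basic_open (X : ringedSpace) (U : opens X) (f : sect U) : opens X :=
  Opens (basic_set_open f).

Lemma basic_open_sub (X : ringedSpace) (U : opens X) (f : sect U) :
  basic_open f `<=` U.
Proof. by move=> x [hx _]. Qed.

(* (U, O_U) is isomorphic to Spec A with A = O(U).  A morphism from (U, O_U) to
   an affine scheme being given by a ring morphism on global sections, this
   means that the canonical morphism U -> Spec A, which sends x to the prime
   {f in A | f vanishes at x}, is an isomorphism.  With D(f) for basic_open f: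
   it is bijective, the D(f) form a basis of the topology of U, and
   O(D(f)) = A_f for all f. *)
Definition affine (X : ringedSpace) (U : opens X) : Prop :=
  [/\ forall P : set (sect U), prime_ideal P ->
        exists! x : X, oset U x /\ P = [set f | ~ basic_set f x],
      forall (V : opens X) x, oset V x -> oset U x ->
        exists f : sect U, basic_set f x /\ basic_set f `<=` V &
      forall f : sect U, is_localization f (res (@basic_open_sub X U f))].

Record scheme := Scheme {
  sch_rs :> ringedSpace;
  sch_local : forall x : sch_rs, local_ring (stalk x);
  sch_affine : forall x : sch_rs, exists U : opens sch_rs, oset U x /\ affine U
}.

Record integralScheme := IntegralScheme {
  int_sch :> scheme;
  int_nonempty : exists x : int_sch, True;
  int_domain : forall U : opens int_sch, (exists x, oset U x) ->
    (1 : sect U) <> 0 /\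
    forall a b : sect U, a * b = 0 -> a = 0 \/ b = 0
}.

Section LocalRing.
Variables (X : integralScheme) (x : X).
Local Notation A := (stalk x).

Lemma stalk_oner_neq0 : (1 : A) != 0.
Proof. by apply/eqP; case: (sch_local x). Qed.

HB.instance Definition _ :=
  GRing.PzSemiRing_isNonZero.Build A stalk_oner_neq0.

Definition stalk_unit : {pred A} := fun a => `[< invertible a >].

Definition stalk_inv (a : A) : A :=
  if pselect (invertible a) is left h then sval (cid h) else a.

Lemma stalk_mulVx : {in stalk_unit, left_inverse 1 stalk_inv *%R}.
Proof.
move=> a /asboolP ha; rewrite /stalk_inv.
by case: pselect => // h; case: (cid h).
Qed.

Lemma stalk_unitPl (a b : A) : b * a = 1 -> stalk_unit a.
Proof. by move=> h; apply/asboolP; exists b. Qed.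

Lemma stalk_invr_out : {in [predC stalk_unit], stalk_inv =1 id}.
Proof.
by move=> a /asboolP ha; rewrite /stalk_inv; case: pselect.
Qed.

HB.instance Definition _ := GRing.ComNzRing_hasMulInverse.Build A
  stalk_mulVx stalk_unitPl stalk_invr_out.

Lemma stalk_domain : GRing.integral_domain_axiom A.
Proof.
move=> a b; have [U [hU [s [t [-> ->]]]]] := germ_ex2 a b.
rewrite [_ * _](stalk_mulE hU) [0](stalk_zeroE hU) => /germ_eq.
move=> [W [Wx [h [h' e]]]].
have := e; rewrite rmorphM rmorph0.
have [_ /(_ (res h s) (res h t)) dom] := int_domain (ex_intro _ x Wx).
move=> /dom[z|z]; apply/orP; [left|right]; apply/eqP.
  by rewrite -(germ_res h hU Wx) z -!stalk_zeroE.
by rewrite -(germ_res h hU Wx) z -!stalk_zeroE.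
Qed.

HB.instance Definition _ := GRing.ComUnitRing_isIntegral.Build A stalk_domain.

Lemma stalk_unitE (a : A) : (a \is a GRing.unit) = `[< invertible a >].
Proof. by []. Qed.

Definition max_ideal : {pred A} := fun a => a \isn't a GRing.unit.

Lemma max_ideal_closed : idealr_closed max_ideal.
Proof.
have inE' (a : A) : (a \in max_ideal) = (a \isn't a GRing.unit) by [].
split; rewrite ?inE' ?unitr0 ?unitr1 // => a u v.
rewrite !inE' => hu hv; rewrite stalk_unitE; apply/asboolP.
apply: (sch_local x).2; last by move: hv; rewrite stalk_unitE => /asboolP.
move=> inv_au; move: hu; have : a * u \is a GRing.unit by apply/asboolP.
by rewrite unitrM => /andP[_ ->].
Qed.

HB.instance Definition _ := isIdealr.Build A max_ideal max_ideal_closed.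

Definition residue_field := {ideal_quot max_ideal}.

HB.instance Definition _ := Quotient.on residue_field.
HB.instance Definition _ := GRing.ComNzRing.on residue_field.

Definition residue (a : A) : residue_field := \pi_residue_field a.

Lemma residue_eq0 (a : A) : (residue a == 0) = (a \isn't a GRing.unit).
Proof.
have e0 : (0 : residue_field) = \pi_residue_field (0 : A).
  exact: (esym (rmorph0 \pi_{ideal_quot (max_ideal : idealr A)})).
have := Quotient.idealrBE (max_ideal : idealr A) a 0; rewrite subr0 => e.
by rewrite e0 /residue; exact: (esym e).
Qed.

Definition residue_inv (a : residue_field) : residue_field :=
  residue (repr a)^-1.

Lemma residueK (a : residue_field) : residue (repr a) = a.
Proof. exact: reprK. Qed.

Lemma residueM (a b : A) : residue (a * b) = residue a * residue b.
Proof. exact: (rmorphM \pi_{ideal_quot (max_ideal : idealr A)} a b). Qed.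

Lemma residue_mulVf (a : residue_field) : a != 0 -> residue_inv a * a = 1.
Proof.
rewrite -{1}[a]residueK residue_eq0 negbK => ua.
rewrite /residue_inv -{2}[a]residueK -residueM mulVr //.
exact: (rmorph1 \pi_{ideal_quot (max_ideal : idealr A)}).
Qed.

Lemma residue_inv0 : residue_inv 0 = 0.
Proof.
apply/eqP; rewrite residue_eq0 unitrV -residue_eq0.
by rewrite residueK.
Qed.

HB.instance Definition _ := GRing.ComNzRing_isField.Build residue_field
  residue_mulVf residue_inv0.

End LocalRing.

Definition opre (Y X : topologicalType) (f : Y -> X) (cf : continuous f)
  (U : opens X) : opens Y :=
  Opens ((iffLR (continuousP _) cf) _ (opens_open U)).

Record ringedSpaceMor (Y X : ringedSpace) := RingedSpaceMor {
  mor_fun :> Y -> X;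
  mor_cont : continuous mor_fun;
  pull : forall U : opens X, {rmorphism sect U -> sect (opre mor_cont U)};
  pull_res : forall (U V : opens X) (h : V `<=` U)
    (h' : opre mor_cont V `<=` opre mor_cont U) (s : sect U),
    pull V (res h s) = res h' (pull U s)
}.

Arguments mor_cont {Y X} f : rename.
Arguments pull {Y X} f U : rename.
Arguments pull_res {Y X} f {U V} h h' s : rename.

Definition stalk_map (Y X : ringedSpace) (f : ringedSpaceMor Y X) (y : Y)
  (g : stalk (f y)) : stalk y :=
  @germ Y y (opre (mor_cont f) (pg_dom (repr g))) (pg_in (repr g))
    (pull f (pg_dom (repr g)) (pg_sect (repr g))).

Arguments stalk_map {Y X} f y g.

Record schemeMor (Y X : scheme) := SchemeMor {
  sch_mor :> ringedSpaceMor Y X;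
  mor_local : forall (y : Y) (g : stalk (sch_mor y)),
    invertible (stalk_map sch_mor y g) -> invertible g
}.

Definition residue_map (Y X : integralScheme) (f : schemeMor Y X) (y : Y)
  (a : residue_field (f y)) : residue_field y :=
  residue (stalk_map f y (repr a)).

Arguments residue_map {Y X} f y a.

Definition frac_map (A B : idomainType) (f : A -> B) (a : {fraction A}) :
  {fraction B} :=
  FracField.tofrac (f \n_(repr a)) / FracField.tofrac (f \d_(repr a)).

Definition finite_map (A B : comPzRingType) (f : A -> B) : Prop :=
  exists (n : nat) (s : 'I_n -> B), forall b, exists c : 'I_n -> A,
    b = \sum_i f (c i) * s i.

Definition finite_mor (Y X : scheme) (f : schemeMor Y X) : Prop :=
  forall U : opens X, affine U ->
    affine (opre (mor_cont f) U) /\ finite_map (pull f U).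

Definition surjective_mor (Y X : scheme) (f : schemeMor Y X) : Prop :=
  forall x : X, exists y : Y, f y = x.

(* Used when A and B are fields. *)
Definition separable_ext (A B : idomainType) (f : A -> B) : Prop :=
  forall b, exists2 q : {poly A}, separable_poly q & root (map_poly f q) b.

Definition generic_pt (X : topologicalType) (x : X) : Prop :=
  closure [set x] = setT.

(* The function fields are the stalks at the generic points. *)
Definition separable_mor (Y X : integralScheme) (f : schemeMor Y X) : Prop :=
  forall y : Y, generic_pt y -> separable_ext (stalk_map f y).

Definition normal (X : integralScheme) : Prop :=
  forall (x : X) (a : {fraction stalk x}),
    integralOver (@FracField.tofrac (stalk x)) a ->
    exists b : stalk x, a = FracField.tofrac b.

Definition F_finite (p : nat) (k : fieldType) : Prop :=
  finite_map (fun a : k => a ^+ p).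

Definition finite_type_algebra (k : fieldType) (A : comPzRingType)
  (f : k -> A) : Prop :=
  exists s : seq A, forall P : set A,
    (forall c, P (f c)) -> (forall a, a \in s -> P a) ->
    (forall a b, P a -> P b -> P (a + b)) ->
    (forall a b, P a -> P b -> P (a * b)) -> forall a, P a.

(* A morphism X -> Spec k is given by a ring morphism k -> O(X). *)
Definition finite_type (k : fieldType) (X : scheme)
  (i : {rmorphism k -> sect (oT X)}) : Prop :=
  exists (n : nat) (U : 'I_n -> opens X),
    (forall x : X, exists j, oset (U j) x) /\
    forall j, affine (U j) /\
      finite_type_algebra (fun c => res (sub_oT (U j)) (i c)).

Definition F_finite_variety (p : nat) (X : integralScheme) : Prop :=
  exists (k : fieldType) (i : {rmorphism k -> sect (oT X)}),
    [/\ p \in [pchar k], F_finite p k & finite_type i].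

Definition uniformizer (A : idomainType) (t : A) : Prop :=
  t != 0 /\ forall a, a \isn't a GRing.unit <-> exists b, a = t * b.

(* Meaningful when A is a discrete valuation ring and a is not 0. *)
Definition ord (A : idomainType) (a : A) : nat :=
  xget 0%N [set n | exists t u,
    [/\ uniformizer t, u \is a GRing.unit & a = u * t ^+ n]].

Definition ram_index (A B : idomainType) (f : A -> B) : nat :=
  xget 0%N [set n | exists2 t, uniformizer t & n = ord (f t)].

(* The irreducible closed subsets of a scheme are the closures of its points, so
   this says that closure [set x] has codimension one. *)
Definition codim_one (X : topologicalType) (x : X) : Prop :=
  ~ generic_pt x /\
  forall z : X, closure [set z] x -> z = x \/ generic_pt z.

(* The fields of fractions of the two stalks are the function fields.  A map
   between rings one of which has no uniformizer has ram_index 0, so the last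
   clause also forces uniformizers to exist. *)
Definition tame_at (p : nat) (Y X : integralScheme) (f : schemeMor Y X)
  (y : Y) : Prop :=
  let fy : stalk (f y) -> stalk y := stalk_map f y in
  [/\ finite_map (frac_map fy) /\ separable_ext (frac_map fy),
      separable_ext (residue_map f y) &
      ~~ (p %| ram_index fy)%N].

Definition tame_in_codim_one (p : nat) (Y X : integralScheme)
  (f : schemeMor Y X) : Prop :=
  forall y : Y, codim_one y -> tame_at p f y.

(* The coefficients of a Q-divisor, of which only those at points of
   codimension one are meaningful. *)
Definition qdiv (X : ringedSpace) : Type := X -> rat.

Definition qdiv_le (X : ringedSpace) (D E : qdiv X) : Prop :=
  forall x : X, codim_one x -> D x <= E x.

Definition qdiv_eq (X : ringedSpace) (D E : qdiv X) : Prop :=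
  forall x : X, codim_one x -> D x = E x.

(* A local equation t ^ n at f y pulls back to a function of order
   n * ram_index at y. *)
Definition qdiv_pullback (Y X : integralScheme) (f : schemeMor Y X)
  (D : qdiv X) : qdiv Y :=
  fun y => (ram_index (stalk_map f y))%:R * D (f y).

Definition Ram (Y X : integralScheme) (f : schemeMor Y X) : qdiv Y :=
  fun y => (ram_index (stalk_map f y))%:R - 1.

Definition frob_linear (q : nat) (A : comPzRingType) (phi : A -> A) : Prop :=
  (forall a b, phi (a + b) = phi a + phi b) /\
  (forall a b, phi (a ^+ q * b) = a * phi b).

(* Hom_{O_X}(F^e_* O_X, O_X): O_X acts on F^e_* O_X, which is O_X as a sheaf of
   abelian groups, through p^e-th powers. *)
Record frobHom (p e : nat) (X : ringedSpace) := FrobHom {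
  frob_app :> forall U : opens X, sect U -> sect U;
  frob_appP : forall U : opens X, frob_linear (p ^ e) (@frob_app U);
  frob_res : forall (U V : opens X) (h : V `<=` U) (s : sect U),
    frob_app (res h s) = res h (frob_app s)
}.

Arguments frob_app {p e X} f U s : rename.

Definition frob_nonzero (p e : nat) (X : ringedSpace) (psi : frobHom p e X) :
  Prop := exists (U : opens X) (s : sect U), psi U s <> 0.

Definition extends (p e : nat) (Y X : scheme) (f : schemeMor Y X)
  (psibar : frobHom p e Y) (psi : frobHom p e X) : Prop :=
  forall (U : opens X) (s : sect U),
    psibar (opre (mor_cont f) U) (pull f U s) = pull f U (psi U s).

Definition stalk_frob (p e : nat) (X : ringedSpace) (psi : frobHom p e X)
  (x : X) (g : stalk x) : stalk x :=
  germ (pg_in (repr g)) (psi (pg_dom (repr g)) (pg_sect (repr g))).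

(* Phi generates Hom_A(A^{1/q}, A) as an A^{1/q}-module, where c^{1/q} acts on
   phi by phi (c^{1/q} _). *)
Definition frob_generator (q : nat) (A : comPzRingType) (Phi : A -> A) : Prop :=
  frob_linear q Phi /\
  forall phi, frob_linear q phi -> exists c, forall a, phi a = Phi (c * a).

Definition D_psi (p e : nat) (X : integralScheme) (psi : frobHom p e X)
  (x : X) : nat :=
  xget 0%N [set n | exists (Phi : stalk x -> stalk x) (c : stalk x),
    [/\ frob_generator (p ^ e) Phi,
        forall a, stalk_frob psi a = Phi (c * a) & n = ord c]].

Definition Delta (p e : nat) (X : integralScheme) (psi : frobHom p e X) :
  qdiv X :=
  fun x => (D_psi psi x)%:R / (p ^ e - 1)%N%:R.

(* Main.v *)
From HB Require Import structures.
Require Import Defs.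
From mathcomp Require Import all_boot all_order all_algebra separable.
From mathcomp Require Import zify ring.
From mathcomp Require Import boolp classical_sets topology_structure.

Set Implicit Arguments.
Unset Strict Implicit.
Unset Printing Implicit Defensive.
Import Order.TTheory GRing.Theory Num.Theory.
Local Open Scope classical_set_scope.
Local Open Scope ring_scope.

(* All rings involved are viewed inside the function fields K of X and L of Y, and
   psi extends uniquely to a q-linear map psi_K of K (q = p^e).  Since L = K L^q
   (separability), psi_K extends uniquely to a q-linear map psi_L of L, and an
   extension of psi to Y is the same as the statement that psi_L preserves O_Y.
   As Y is normal and noetherian, this can be tested at the points of codimension
   one (an algebraic Hartogs lemma).

   At such a point let A -> B be the extension of discrete valuation rings, with
   uniformizers t, T and t = v T^n, v a unit.  The coefficient d of D_psi is
   characterized by {z in K | psi_K (z A) in A} = t^-d A, and everything reduces to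
     {z in L | psi_L (z B) in B} = T^((n-1)(q-1) - n d) B.
   The numerical semigroup generated by the coprime integers n and q contains every
   integer >= (n-1)(q-1), and the residue field of B is generated by that of A and
   by its own q-th powers, so T^((n-1)(q-1)) B lies in the closure of A[B^q], on
   which psi_L is computed by psi_K.  Conversely (n-1)(q-1) - 1 is not in the
   semigroup, and the elements t^(q-1-d) a T^-q, of valuation
   (n-1)(q-1) - 1 - n d, show that the exponent is optimal. *)

(** * Noetherian subrings *)

(** Passing to the closure of [A[B^q]] is harmless only if psi_L is T-adically continuous. This
    amounts to a common denominator, a nonzero g with g psi_L(B) inside B, and it is extracted from
    the finiteness of the morphism over an affine chart. The exponent settles all claims at once.
    The number 1 lies in {z | psi_L (z B) in B} iff n d >= (n-1)(q-1), which after division by q - 1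
    is the inequality between n d / (q-1) and n - 1, that is, between the pullback and the
    ramification divisor. If psi_L comes from Y, the same module is T^-D B with D its own
    coefficient, so D = n d - (n-1)(q-1), which is the equality of divisors. Describing a
    coefficient by such a module, and not by a generator of Hom, is what makes X and Y comparable:
    no compatible generators have to be chosen on the two sides. It also shows that the choices
    hidden in [D_psi] do not matter. Rings are subsets of a field so that stalks at different points
    can be compared and intersected. *)

Definition is_subring (A : comNzRingType) (R : set A) : Prop :=
  [/\ R 1, forall x y, R x -> R y -> R (x - y)
    & forall x y, R x -> R y -> R (x * y)].

Section Subring.
Variables (A : comNzRingType) (R : set A) (subR : is_subring R).

Lemma subring1 : R 1. Proof. by case: subR. Qed.

Lemma subringB x y : R x -> R y -> R (x - y).
Proof. by case: subR => _ h _; exact: h. Qed.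

Lemma subringM x y : R x -> R y -> R (x * y).
Proof. by case: subR => _ _; exact. Qed.

Lemma subring0 : R 0.
Proof. by rewrite -(subrr 1); apply: subringB; exact: subring1. Qed.

Lemma subringN x : R x -> R (- x).
Proof. by move=> Rx; rewrite -sub0r; apply: subringB => //; exact: subring0. Qed.

Lemma subringD x y : R x -> R y -> R (x + y).
Proof. by move=> Rx Ry; rewrite -[y]opprK; apply: subringB => //; exact: subringN. Qed.

Lemma subringX x n : R x -> R (x ^+ n).
Proof.
by move=> Rx; elim: n => [|n IHn]; rewrite ?exprS; [exact: subring1|exact: subringM].
Qed.

Lemma subring_sum (I : Type) (r : seq I) (P : pred I) (F : I -> A) :
  (forall i, P i -> R (F i)) -> R (\sum_(i <- r | P i) F i).
Proof.
by move=> RF; apply: big_ind => //; [exact: subring0|exact: subringD].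
Qed.

End Subring.

Definition span (A : comNzRingType) (R : set A) (a : nat -> A) (n : nat) : set A :=
  [set x | exists2 c : nat -> A, (forall i, R (c i)) & x = \sum_(i < n) c i * a i].

(* Sequential form of the ascending chain condition for the ideals of R. *)
Definition noetherian (A : comNzRingType) (R : set A) : Prop :=
  forall a : nat -> A, (forall n, R (a n)) -> exists n, span R a n (a n).

Section Span.
Variables (A : comNzRingType) (R : set A) (subR : is_subring R).
Implicit Types a b : nat -> A.

Lemma spanD a n x y : span R a n x -> span R a n y -> span R a n (x + y).
Proof.
move=> [c Rc ->] [d Rd ->]; exists (fun i => c i + d i).
  by move=> i; apply: subringD.
by rewrite -big_split; apply: eq_bigr => i _; rewrite mulrDl.
Qed.

Lemma spanZ a n x y : R x -> span R a n y -> span R a n (x * y).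
Proof.
move=> Rx [c Rc ->]; exists (fun i => x * c i).
  by move=> i; apply: subringM.
by rewrite mulr_sumr; apply: eq_bigr => i _; rewrite mulrA.
Qed.

Lemma span0 a n : span R a n 0.
Proof.
exists (fun=> 0); first by move=> _; exact: subring0.
by rewrite big1 // => i _; rewrite mul0r.
Qed.

Lemma span_sum a n (I : Type) (r : seq I) (P : pred I) (F : I -> A) :
  (forall i, P i -> span R a n (F i)) -> span R a n (\sum_(i <- r | P i) F i).
Proof.
by move=> RF; apply: big_ind => //; [exact: span0|exact: spanD].
Qed.

Lemma span_gen a n i : (i < n)%N -> span R a n (a i).
Proof.
move=> lt_in; exists (fun j => (j == i)%:R).
  by move=> j; case: (_ == _); [exact: subring1|exact: subring0].
rewrite (bigD1 (Ordinal lt_in)) //= eqxx mul1r big1 ?addr0 // => j.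
by rewrite -val_eqE /= => /negbTE->; rewrite mul0r.
Qed.

Lemma span_trans a b m n x : (forall i, (i < n)%N -> span R b m (a i)) ->
  span R a n x -> span R b m x.
Proof.
move=> sab [c Rc ->]; apply: span_sum => i _.
by apply: spanZ => //; apply: sab.
Qed.

Lemma span_widen a m n x : (m <= n)%N -> span R a m x -> span R a n x.
Proof.
by move=> le_mn; apply: span_trans => i im; apply: span_gen; apply: leq_trans le_mn.
Qed.

Lemma span_sub a n x : (forall i, R (a i)) -> span R a n x -> R x.
Proof.
by move=> Ra [c Rc ->]; apply: subring_sum => // i _; apply: subringM.
Qed.

End Span.

(** * Hilbert's basis theorem *)

Definition polys_over (A : comNzRingType) (R : set A) : set {poly A} :=
  [set f | forall i, R f`_i].

Section Hilbert.
Variables (A : comNzRingType) (R : set A) (subR : is_subring R).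

Lemma polys_over_subring : is_subring (polys_over R).
Proof.
split.
- by move=> i; rewrite coef1; case: (_ == _); [exact: subring1|exact: subring0].
- by move=> f g Rf Rg i; rewrite coefB; apply: subringB.
- move=> f g Rf Rg i; rewrite coefM; apply: subring_sum => // j _.
  exact: subringM.
Qed.

Lemma polys_overC c : R c -> polys_over R c%:P.
Proof. by move=> Rc i; rewrite coefC; case: eqP => // _; exact: subring0. Qed.

Lemma polys_overXn n : polys_over R 'X^n.
Proof. by move=> i; rewrite coefXn; case: (_ == _); [exact: subring1|exact: subring0]. Qed.

(** Elements [g n] of least degree outside the span of their predecessors are picked from the ideal
    generated by [f]; a relation between their leading coefficients then produces such an element of
    smaller degree. *)
Theorem noetherian_poly : noetherian R -> noetherian (polys_over R).
Proof.
move=> noethR f Rf; apply: contrapT => /forallNP nof.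
have subP := polys_over_subring.
pose I : set {poly A} := [set h | exists n, span (polys_over R) f n h].
pose outside (s : seq {poly A}) : set {poly A} :=
  [set h | I h /\ ~ span (polys_over R) (nth 0 s) (size s) h].
pose minimal (s : seq {poly A}) (h : {poly A}) :=
  outside s h /\ forall h', outside s h' -> (size h <= size h')%N.
have ex_min s : (forall h, h \in s -> I h) -> exists h, minimal s h.
  move=> sI.
  (* Each entry of [s] involves finitely many [f i], so one [N] bounds them all, and then [f N]
     itself is outside the span of [s]. *)
  have [N sN] : exists N, forall h, h \in s -> span (polys_over R) f N h.
    elim: s sI => [|h s IHs] sI; first by exists 0%N.
    have [|N sN] := IHs; first by move=> h' hs; apply: sI; rewrite inE hs orbT.
    have [|M hM] := sI h; first by rewrite inE eqxx.
    exists (maxn M N) => h'; rewrite inE => /orP[/eqP->|/sN].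
      by apply: span_widen hM => //; exact: leq_maxl.
    by apply: span_widen => //; exact: leq_maxr.
  have Ps : exists m, `[< exists2 h, outside s h & size h = m >].
    exists (size (f N)); apply/asboolP; exists (f N) => //; split.
      by exists N.+1; apply: span_gen.
    move=> fN; apply: (nof N); apply: span_trans fN => // i si.
    by apply: sN; rewrite mem_nth.
  have [m /asboolP[h oh hm] minm] := ex_minnP Ps.
  exists h; split=> // h' oh'; rewrite hm; apply: minm; apply/asboolP.
  by exists h'.
have /choice[next nextP] : forall s, exists h,
    (forall h, h \in s -> I h) -> minimal s h.
  move=> s; have [sI|nsI] := pselect (forall h, h \in s -> I h).
    by have [h hm] := ex_min s sI; exists h.
  by exists 0.
pose G n := iter n (fun s => rcons s (next s)) [::].
pose g n := next (G n).
have sizeG n : size (G n) = n by elim: n => //= n IHn; rewrite size_rcons IHn.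
have GI n : forall h, h \in G n -> I h.
  elim: n => // n IHn h; rewrite /= mem_rcons inE => /orP[/eqP->|/IHn//].
  by have [[]] := nextP (G n) IHn.
have nthG n i : (i < n)%N -> (G n)`_i = g i.
  elim: n => // n IHn; rewrite ltnS leq_eqVlt /= nth_rcons sizeG.
  by case/orP=> [/eqP->|lt_in]; rewrite ?ltnn ?eqxx // lt_in IHn.
have gP n : minimal (G n) (g n) by apply: nextP; exact: GI.
have outG n h : outside (G n) h <-> I h /\ ~ span (polys_over R) g n h.
  rewrite /outside /= sizeG; split=> -[Ih sh]; split=> // s'; apply: sh.
    by apply: span_trans s' => // i lt_in; rewrite -(nthG n) //; apply: span_gen.
  by apply: span_trans s' => // i lt_in; rewrite (nthG n) //; apply: span_gen.
have Ig n : I (g n) by have [/outG[]] := gP n.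
have IP h : I h -> polys_over R h by case=> n; apply: span_sub.
have size_g n m : (n <= m)%N -> (size (g n) <= size (g m))%N.
  move=> le_nm; have [_] := gP n; apply; apply/outG; split=> // gm.
  by have [/outG[_ ns] _] := gP m; apply: ns; exact: (span_widen subP le_nm gm).
have g_neq0 n : g n != 0.
  apply/eqP=> g0; have [/outG[_ ns] _] := gP n.
  by apply: ns; rewrite g0; exact: span0.
have [|n [c Rc lead_n]] := noethR (fun n => lead_coef (g n)).
  by move=> n; apply: IP (Ig n) _.
(* The relation between leading coefficients, each [g i] being shifted to the degree of [g n]. The
   sizes of the [g i] do not decrease, so the truncated subtraction is exact. *)
pose h' := \sum_(i < n) ((c i)%:P * 'X^(size (g n) - size (g i))) * g i.
have sh' : span (polys_over R) g n h'.
  exists (fun i => (c i)%:P * 'X^(size (g n) - size (g i))) => // i.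
  by apply: (subringM subP); [exact: polys_overC|exact: polys_overXn].
have ID x y : I x -> I y -> I (x + y).
  move=> [a xa] [b yb]; exists (maxn a b); apply: spanD => //.
    by apply: span_widen xa => //; exact: leq_maxl.
  by apply: span_widen yb => //; exact: leq_maxr.
have IZ x y : polys_over R x -> I y -> I (x * y).
  by move=> Px [a ya]; exists a; apply: spanZ.
have I0 : I 0 by exists 0%N; exact: span0.
have IN1 : polys_over R (-1) by apply: subringN (subring1 subP).
have Ih' : I h'.
  apply: big_ind => // i _; apply: IZ => //.
  by apply: (subringM subP); [exact: polys_overC|exact: polys_overXn].
have [out_n min_n] := gP n.
have out_h : outside (G n) (g n - h').
  apply/outG; split; first by apply: ID => //; rewrite -mulN1r; apply: IZ.
  move=> s; have [/outG[_ ns] _] := gP n.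
  by apply: ns; rewrite -[g n](subrK h'); apply: spanD.
have := min_n _ out_h; apply/negP; rewrite -ltnNge.
have [k size_n] : exists k, size (g n) = k.+1.
  by exists (size (g n)).-1; rewrite prednK // lt0n size_poly_eq0.
rewrite size_n ltnS; apply/leq_sizeP => j le_kj.
have coef_h' : h'`_j = \sum_(i < n) c i * (g i)`_(j - (k.+1 - size (g i))).
  rewrite coef_sum; apply: eq_bigr => i _.
  rewrite -mulrA coefCM coefXnM size_n.
  have : (0 < size (g i))%N by rewrite lt0n size_poly_eq0.
  by move=> s1; rewrite ifN // -leqNgt; lia.
rewrite coefB coef_h'; move: le_kj; rewrite leq_eqVlt => /orP[/eqP ej|lt_kj].
  apply/eqP; rewrite subr_eq0 -ej; apply/eqP.
  move: lead_n; rewrite /lead_coef size_n /= => ->; apply: eq_bigr => i _.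
  have : (size (g i) <= k.+1)%N by rewrite -size_n size_g // ltnW.
  have : (0 < size (g i))%N by rewrite lt0n size_poly_eq0.
  move=> s1 s2; congr (_ * (g i)`_ _); by move: (size (g i)) s1 s2 => m; lia.
rewrite nth_default ?size_n // big1 ?subrr // => i _.
rewrite nth_default ?mulr0 //.
have : (size (g i) <= k.+1)%N by rewrite -size_n size_g // ltnW.
by move: (size (g i)) => m s2; lia.
Qed.

End Hilbert.

Lemma noetherian_image (A B : comNzRingType) (h : {rmorphism A -> B}) (R : set A) :
  noetherian R -> noetherian (h @` R).
Proof.
move=> noethR b Rb.
have /choice[a aP] : forall n, exists x, R x /\ h x = b n.
  by move=> n; have [x Rx hx] := Rb n; exists x.
have [|n [c Rc an]] := noethR a; first by move=> n; case: (aP n).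
exists n, (fun i => h (c i)); first by move=> i; exists (c i).
rewrite -(proj2 (aP n)) an rmorph_sum; apply: eq_bigr => i _.
by rewrite rmorphM (proj2 (aP i)).
Qed.

Lemma subring_image (A B : comNzRingType) (h : {rmorphism A -> B}) (R : set A) :
  is_subring R -> is_subring (h @` R).
Proof.
move=> subR; split.
- by exists 1; rewrite ?rmorph1 //; exact: subring1.
- by move=> _ _ [x Rx <-] [y Ry <-]; exists (x - y); rewrite ?rmorphB //; exact: subringB.
- by move=> _ _ [x Rx <-] [y Ry <-]; exists (x * y); rewrite ?rmorphM //; exact: subringM.
Qed.

Lemma subring_range (A : comPzRingType) (B : comNzRingType) (h : {rmorphism A -> B}) :
  is_subring (range h).
Proof.
split.
- by exists 1; rewrite ?rmorph1.
- by move=> _ _ [a _ <-] [b _ <-]; exists (a - b); rewrite ?rmorphB.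
- by move=> _ _ [a _ <-] [b _ <-]; exists (a * b); rewrite ?rmorphM.
Qed.

Lemma noetherian_field (k : fieldType) : noetherian [set: k].
Proof.
move=> a _; have [a0|a0] := eqVneq (a 0%N) 0.
  by exists 0%N, (fun=> 0) => //; rewrite big_ord0.
by exists 1%N, (fun=> a 1%N / a 0%N) => //; rewrite big_ord1 divfK.
Qed.

(** A generator [x] is adjoined to [R] by evaluating the polynomials over [R] at [x]. The last
    clause identifies the result as the generated subring. *)
Lemma noetherian_generated (k : fieldType) (B : comNzRingType)
  (g : {rmorphism k -> B}) (s : seq B) :
  exists R : set B, [/\ is_subring R, noetherian R, forall c, R (g c),
    forall x, x \in s -> R x &
    forall S : set B, is_subring S -> (forall c, S (g c)) ->
      (forall x, x \in s -> S x) -> R `<=` S].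
Proof.
elim: s => [|x s [R [subR noethR Rk Rs Rmin]]].
  exists (g @` [set: k]); split.
  - by apply: subring_image; split.
  - by apply: noetherian_image; exact: noetherian_field.
  - by move=> c; exists c.
  - by [].
  - by move=> S _ Sk _ _ [c _ <-].
have RR y : R y -> (horner_eval x @` polys_over R) y.
  by move=> Ry; exists y%:P; [exact: polys_overC|rewrite /horner_eval hornerC].
exists (horner_eval x @` polys_over R); split.
- exact: subring_image (polys_over_subring subR).
- exact: noetherian_image (noetherian_poly subR noethR).
- by move=> c; exact: RR.
- move=> y; rewrite inE => /orP[/eqP->|/Rs/RR//].
  by exists 'X; [rewrite -['X]expr1; exact: polys_overXn|rewrite /horner_eval hornerX].
- move=> S subS Sk Ss _ [f Rf <-]; rewrite /horner_eval horner_coef.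
  have SR : R `<=` S by apply: Rmin => // y ys; apply: Ss; rewrite inE ys orbT.
  apply: subring_sum => // i _; apply: subringM => //; first exact: SR.
  by apply: subringX => //; apply: Ss; rewrite inE eqxx.
Qed.

Lemma noetherian_finite_type (k : fieldType) (A : comPzRingType) (B : comNzRingType)
  (f : {rmorphism k -> A}) (h : {rmorphism A -> B}) :
  finite_type_algebra f -> noetherian (range h).
Proof.
move=> [s sP]; have [R [subR noethR Rk Rs Rmin]] :=
  noetherian_generated (h \o f : {rmorphism k -> B}) (map h s).
suff -> : range h = R by [].
apply/seteqP; split=> [_ [a _ <-]|].
  apply: (sP (fun a => R (h a))) => [c|b bs|b c Rb Rc|b c Rb Rc].
  - exact: Rk.
  - by apply: Rs; rewrite map_f.
  - by rewrite rmorphD; exact: subringD.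
  - by rewrite rmorphM; exact: subringM.
apply: Rmin => [|c|_ /mapP[a _ ->]]; [exact: subring_range|by exists (f c)|by exists a].
Qed.

(** Almost integral elements are integral: the chain condition is applied to the sequence
    [x * theta ^+ k], and [x] is cancelled. *)
Lemma noetherian_integral (L : fieldType) (R : set L) (x theta : L) :
  noetherian R -> x != 0 -> (forall k, R (x * theta ^+ k)) ->
  exists n (c : nat -> L), (forall i, R (c i)) /\
    theta ^+ n = \sum_(i < n) c i * theta ^+ i.
Proof.
move=> noethR x0 Rx; have [n [c Rc e]] := noethR _ Rx; exists n, c; split=> //.
apply: (mulfI x0); rewrite e mulr_sumr; apply: eq_bigr => i _.
by rewrite mulrCA.
Qed.

(* The prime is found among the conductors {x | x c phi in R} containing no power
   of g: a maximal one is prime. *)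
Lemma prime_conductor (L : fieldType) (R : set L) (phi g : L) :
  is_subring R -> noetherian R -> R g -> (forall m, ~ R (g ^+ m * phi)) ->
  exists c, [/\ R c, ~ R (g * c * phi) & forall x y, R x -> R y ->
    R (x * y * c * phi) -> R (x * c * phi) \/ R (y * c * phi)].
Proof.
move=> subR noethR Rg gphi.
pose P c : set L := [set x | R x /\ R (x * c * phi)].
pose C : set L := [set c | R c /\ forall m, ~ R (g ^+ m * c * phi)].
have PM c c' : R c' -> P c `<=` P (c * c').
  move=> Rc' x [Rx Rxc]; split=> //.
  by rewrite (_ : x * _ * phi = c' * (x * c * phi)); [exact: subringM|ring].
(* Otherwise the conductors [P (c n)] grow forever, and elements [x n] that are new at stage n
   contradict the chain condition. *)
have [c [[Rc Cc] max_c]] : exists c, C c /\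
    forall c', R c' -> C (c * c') -> P (c * c') `<=` P c.
  apply: contrapT => /forallNP noc.
  have /choice[next nextP] : forall c, exists d, C c ->
      [/\ R d.1, C (c * d.1), P (c * d.1) d.2 & ~ P c d.2].
    move=> c; have [Cc|] := pselect (C c); last by exists (0, 0).
    have /not_andP[//|/existsNP[c' /not_implyP[Rc' /not_implyP[Cc']]]] := noc c.
    by move=> /existsNP[x /not_implyP[Px nPx]]; exists (c', x).
  pose c n := iter n (fun c => c * (next c).1) 1; pose x n := (next (c n)).2.
  have Cc n : C (c n).
    elim: n => [|n /nextP[]//]; split; first exact: subring1.
    by move=> m; rewrite mulr1; exact: gphi.
  have Pmono m n : (m <= n)%N -> P (c m) `<=` P (c n).
    elim: n => [|n IHn]; first by rewrite leqn0 => /eqP->.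
    rewrite leq_eqVlt => /orP[/eqP->//|/IHn s] z /s.
    by have [Rd _ _ _] := nextP _ (Cc n); exact: PM.
  have [|n [d Rd e]] := noethR x; first by move=> n; case: (nextP _ (Cc n)) => _ _ [].
  have [_ _ [Rx _] []] := nextP _ (Cc n); split=> //; rewrite -/(x n) e !mulr_suml.
  apply: subring_sum => // i _; rewrite -!mulrA; apply: subringM => //.
  rewrite mulrA; have [_ _ Px _] := nextP _ (Cc i).
  by have [] := Pmono i.+1 n (ltn_ord i) _ Px.
exists c; split=> //.
  by have := Cc 1%N; rewrite expr1.
move=> x y Rx Ry Rxy; have [yP|yP] := pselect (R (y * c * phi)); [by right|left].
(* [x] lies in [P (c * y)], which maximality puts inside [P c] once [c * y] is in [C]. A power
   [g ^+ m] violating this would place [y] in [P (c * g ^+ m)], hence in [P c]. *)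
suff Ccy : C (c * y).
  have [|_] := max_c y Ry Ccy x; last by [].
  by split=> //; rewrite (_ : _ * phi = x * y * c * phi) //; ring.
split; first exact: subringM.
move=> m Rm; apply: yP.
have Cgm : C (c * g ^+ m).
  split; first by apply: subringM => //; exact: subringX.
  move=> l; rewrite (_ : _ * phi = g ^+ (l + m) * c * phi); last by rewrite exprD; ring.
  exact: Cc.
have [|_] := max_c _ (subringX subR m Rg) Cgm y; last by [].
by split=> //; rewrite (_ : _ * phi = g ^+ m * (c * y) * phi) //; ring.
Qed.

(** A relation between the numerators is one between the fractions, because the denominators are
    units of [B]. *)
Lemma noetherian_fractions (L : fieldType) (R B : set L) :
  noetherian R -> is_subring B -> R `<=` B ->
  (forall x, B x -> exists a f, [/\ R a, R f, f != 0, B f^-1 & x = a / f]) ->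
  noetherian B.
Proof.
move=> noethR subB RB fracB x Bx.
have /choice[u uP] : forall n, exists u : L * L,
    [/\ R u.1, R u.2, u.2 != 0, B u.2^-1 & x n = u.1 / u.2].
  by move=> n; have [a [f [Ra Rf f0 Bf ->]]] := fracB _ (Bx n); exists (a, f).
have [|n [c Rc e]] := noethR (fun n => (u n).1); first by move=> n; case: (uP n).
have [_ _ un0 Bun xn] := uP n; exists n; rewrite xn.
exists (fun i => c i * (u i).2 / (u n).2).
  move=> i; do 2!apply: subringM => //; apply: RB => //.
  by case: (uP i).
rewrite e mulr_suml; apply: eq_bigr => i _; have [_ _ ui0 _ ->] := uP i.
by field; rewrite un0 ui0.
Qed.

(** The second equation has no denominators, so it makes sense in the stalk and can be carried from
    the function field to the [{fraction stalk x}] of [normal]. *)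
Lemma fraction_root_homogeneous (L : fieldType) (a b : L) n (c : nat -> L) : b != 0 ->
  (a / b) ^+ n = \sum_(i < n) c i * (a / b) ^+ i <->
  a ^+ n = \sum_(i < n) c i * (a ^+ i * b ^+ (n - i)).
Proof.
move=> b0; have bn0 : b ^+ n != 0 by rewrite expf_neq0.
have e : \sum_(i < n) c i * (a ^+ i * b ^+ (n - i)) =
    (\sum_(i < n) c i * (a / b) ^+ i) * b ^+ n.
  rewrite mulr_suml; apply: eq_bigr => i _.
  rewrite -[in b ^+ n](subnK (ltnW (ltn_ord i))) exprD expr_div_n.
  by field; rewrite expf_neq0.
rewrite e expr_div_n; split=> [<-|->]; first by rewrite divfK.
by rewrite mulfK.
Qed.

(** * Separable extensions and Frobenius *)

Section SeparableFrobenius.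
Variables (k : fieldType) (p : nat) (charp : p \in [pchar k]).
Implicit Types h r : {poly k}.

Let p_gt0 : (0 < p)%N. Proof. exact: prime_gt0 (pcharf_prime charp). Qed.

Lemma deriv_comp_Xp r : (r \Po 'X^p)^`() = 0.
Proof. by rewrite deriv_comp derivXn -mulr_natr -polyC_natr pcharf0 // polyC0 !mulr0. Qed.

(** The derivative of [r \Po 'X^p] is 0. Differentiating [g * h ^+ j] with 0 < j < p shows that h
    divides j times g times the derivative of h; j is invertible and h is coprime to its derivative,
    so h divides g. *)
Lemma separable_dvdp_Xp h r : separable_poly h -> h %| r \Po 'X^p ->
  h ^+ p %| r \Po 'X^p.
Proof.
move=> sep_h h_dv; set F := r \Po _ in h_dv *.
suff dv_hj j : (j <= p)%N -> h ^+ j %| F by exact: dv_hj.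
case: j => [_|j]; first by rewrite expr0 dvd1p.
elim: j => [|j IHj] lt_jp; first by rewrite expr1.
have h0 : h != 0 by apply: separable_poly_neq0.
have /dvdpP[g Fg] := IHj (ltnW lt_jp).
suff /dvdpP[g' eg] : h %| g by rewrite Fg eg -mulrA -exprS dvdp_mull.
have /eqP := deriv_comp_Xp r; rewrite -/F Fg derivM deriv_exp.
rewrite (_ : _ + _ = h ^+ j * (g^`() * h + g * h^`() *+ j.+1)); last first.
  by rewrite -!mulrnAr exprS /=; ring.
rewrite mulf_eq0 expf_eq0 (negbTE h0) andbF /= addrC addr_eq0 => /eqP e.
have : h %| g * h^`() *+ j.+1 by rewrite e dvdpNr dvdp_mull.
rewrite -scaler_nat dvdpZr; last first.
  by rewrite -(dvdn_pcharf charp); apply/negP => /(dvdn_leq (ltn0Sn _)); lia.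
by rewrite Gauss_dvdpl //; move: sep_h; rewrite unlock.
Qed.

(** Sending r to r(X^p) mod h is a linear endomorphism of the polynomials of degree less than deg h.
    It is injective, as [h ^+ p] would divide r(X^p), whose degree is too small; so X is in its
    image. At a root x of h this reads x = w(x^p). *)
Lemma separable_generated_by_Xp h : separable_poly h ->
  exists w : {poly k}, h %| 'X - (w \Po 'X^p).
Proof.
move=> sep_h; have h0 := separable_poly_neq0 sep_h.
pose d := (size h).-1; have size_h : size h = d.+1.
  by rewrite prednK // lt0n size_poly_eq0.
have size_mod r : (size (r %% h)%R <= d)%N by rewrite -ltnS -size_h ltn_modp.
pose f (v : 'rV[k]_d) : 'rV[k]_d := poly_rV ((rVpoly v \Po 'X^p) %% h).
have lin_f : linear f.
  move=> c u v; rewrite /f linearP comp_polyD comp_polyZ modpD modpZl.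
  by rewrite linearP.
pose fL : {linear 'rV[k]_d -> 'rV[k]_d} :=
  HB.pack f (GRing.isLinear.Build k _ _ _ f lin_f).
pose M := lin1_mx fL.
have MP v : v *m M = f v by rewrite mul_rV_lin1.
have freeM : row_free M.
  rewrite -kermx_eq0; apply/rowV0P => v /sub_kermxP; rewrite MP => vM.
  have h_dv : h %| rVpoly v \Po 'X^p.
    by apply/modp_eq0P; rewrite -(poly_rV_K (size_mod _)) -/(f v) vM linear0.
  apply: contraTeq isT => v0; have rv0 : rVpoly v != 0.
    by apply: contraNneq v0 => rv0; rewrite -[v]rVpolyK rv0 linear0.
  have := separable_dvdp_Xp sep_h h_dv.
  have F0 : rVpoly v \Po 'X^p != 0.
    by rewrite comp_poly_eq0 // size_polyXn ltnS.
  move/(dvdp_leq F0).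
  have := size_comp_poly (rVpoly v) 'X^p; rewrite size_polyXn /=.
  have := size_exp h p; rewrite size_h /=.
  have sv : (size (rVpoly v) <= d)%N by exact: size_poly.
  have : size (rVpoly v) != 0%N by rewrite size_poly_eq0.
  have : size (h ^+ p) != 0%N by rewrite size_poly_eq0 expf_neq0.
  have : size (rVpoly v \Po 'X^p) != 0%N by rewrite size_poly_eq0.
  move: (size _) (size _) (size _) sv => a b c; nia.
have /row_fullP[B BM] : row_full M by rewrite row_full_unit -row_free_unit.
pose u := poly_rV ('X %% h) *m B; exists (rVpoly u).
apply/modp_eq0P; rewrite modpD modpN -(poly_rV_K (size_mod (rVpoly u \Po 'X^p))).
by rewrite -/(f u) -MP -mulmxA BM mulmx1 poly_rV_K // subrr.
Qed.

End SeparableFrobenius.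

Lemma exprDn_pchar_sum (R : comNzRingType) (p e : nat) (I : Type) (r : seq I)
  (F : I -> R) : p \in [pchar R] ->
  (\sum_(i <- r) F i) ^+ (p ^ e) = \sum_(i <- r) F i ^+ (p ^ e).
Proof.
move=> charp; have p_pr := pcharf_prime charp.
apply: (big_morph (fun x => x ^+ (p ^ e))) => [x y|].
  rewrite exprDn_pchar // pnatX; apply/orP; left.
  by rewrite (eq_pnat _ (pcharf_eq charp)) pnat_id.
by rewrite expr0n expn_eq0 eqn0Ngt (prime_gt0 p_pr).
Qed.

Section FrobeniusSpan.
Variables (K L : fieldType) (h : {rmorphism K -> L}).

Definition frob_span (q : nat) : set L :=
  [set x | exists s : seq (K * L), x = \sum_(u <- s) h u.1 * u.2 ^+ q].

Lemma frob_spanD q x y : frob_span q x -> frob_span q y -> frob_span q (x + y).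
Proof. by move=> [s ->] [t ->]; exists (s ++ t); rewrite big_cat. Qed.

Lemma frob_spanZ q a x : frob_span q x -> frob_span q (h a * x).
Proof.
move=> [s ->]; exists [seq (a * u.1, u.2) | u <- s]; rewrite big_map mulr_sumr.
by apply: eq_bigr => u _; rewrite rmorphM mulrA.
Qed.

Lemma frob_span_gen q x : frob_span q (x ^+ q).
Proof. by exists [:: (1, x)]; rewrite big_seq1 rmorph1 mul1r. Qed.

Lemma frob_span_sum q (I : Type) (r : seq I) (F : I -> L) :
  (forall i, frob_span q (F i)) -> frob_span q (\sum_(i <- r) F i).
Proof.
move=> sF; apply: big_ind => //; last exact: frob_spanD.
by exists [::]; rewrite big_nil.
Qed.

Variables (p : nat) (charp : p \in [pchar K]).

Let charL : p \in [pchar L]. Proof. exact: rmorph_pchar charp. Qed.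

(** Write x = w(x^p) over K. Each power of x lies in K L^(p^e) by induction, and its p-th power lies
    in K L^(p^(e+1)). *)
Theorem separable_frob_span e x : separable_ext h -> frob_span (p ^ e) x.
Proof.
move=> sep; elim: e x => [|e IHe] x.
  by rewrite -[x]expr1; apply: frob_span_gen.
have [f sep_f root_x] := sep x.
have [w w_dv] := separable_generated_by_Xp charp sep_f.
have -> : x = (map_poly h w).[x ^+ p].
  have : root (map_poly h ('X - (w \Po 'X^p))) x by apply: root_dvdp root_x; rewrite dvdp_map.
  rewrite rmorphB /= map_polyX map_comp_poly map_polyXn /root hornerD hornerN hornerX.
  by rewrite horner_comp hornerXn subr_eq0 => /eqP.
rewrite horner_coef; apply: frob_span_sum => i; rewrite coef_map.
apply: frob_spanZ; have [s sx] := IHe (x ^+ i).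
rewrite -exprM mulnC exprM sx -[p]expn1 exprDn_pchar_sum //; apply: frob_span_sum => u.
rewrite exprMn -rmorphXn; apply: frob_spanZ; rewrite -exprM -expnD.
by rewrite addn1; apply: frob_span_gen.
Qed.

End FrobeniusSpan.

(** * Frobenius-linear maps *)

Section FrobLinear.
Variables (A : comPzRingType) (q : nat) (phi : A -> A) (lin : frob_linear q phi).

Lemma frob_linearD x y : phi (x + y) = phi x + phi y. Proof. by case: lin. Qed.

Lemma frob_linearZ x y : phi (x ^+ q * y) = x * phi y. Proof. by case: lin. Qed.

Lemma frob_linear0 : phi 0 = 0.
Proof. by apply: (addrI (phi 0)); rewrite -frob_linearD !addr0. Qed.

Lemma frob_linear_sum (I : Type) (r : seq I) (P : pred I) (F : I -> A) :
  phi (\sum_(i <- r | P i) F i) = \sum_(i <- r | P i) phi (F i).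
Proof. by apply: (big_morph phi) => [x y|]; rewrite ?frob_linearD ?frob_linear0. Qed.

Lemma frob_linearB x y : phi (x - y) = phi x - phi y.
Proof. by apply/eqP; rewrite eq_sym subr_eq -frob_linearD subrK. Qed.

Lemma frob_linear_comp_mul c : frob_linear q (fun x => phi (c * x)).
Proof.
by split=> x y; rewrite ?mulrDr ?frob_linearD // mulrCA frob_linearZ.
Qed.

End FrobLinear.

(** * Extension along finite separable field extensions *)

Section ExtendFiniteSeparable.
Variables (K L : fieldType) (h : {rmorphism K -> L}) (p e : nat).
Hypotheses (charp : p \in [pchar K]) (fin_h : finite_map h) (sep_h : separable_ext h).
Local Notation q := (p ^ e)%N.

Let charL : p \in [pchar L]. Proof. exact: rmorph_pchar charp. Qed.

Let spanned n (s : 'I_n -> L) : set L :=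
  [set x | exists c : 'I_n -> K, x = \sum_i h (c i) * s i].

Let spannedD n (s : 'I_n -> L) x y : spanned s x -> spanned s y -> spanned s (x + y).
Proof.
move=> [c ->] [d ->]; exists (fun i => c i + d i); rewrite -big_split.
by apply: eq_bigr => i _; rewrite rmorphD mulrDl.
Qed.

Let spannedZ n (s : 'I_n -> L) a x : spanned s x -> spanned s (h a * x).
Proof.
move=> [c ->]; exists (fun i => a * c i); rewrite mulr_sumr.
by apply: eq_bigr => i _; rewrite rmorphM mulrA.
Qed.

(* A spanning family of minimal length stays a basis under the Frobenius, since
   L = K L^q. *)
Lemma ex_frob_basis : exists n (s : 'I_n -> L),
  [/\ forall x, spanned s x, forall x, spanned (fun i => s i ^+ q) x &
      forall c d : 'I_n -> K, \sum_i h (c i) * s i ^+ q = \sum_i h (d i) * s i ^+ q ->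
        c =1 d].
Proof.
pose Q n := `[< exists s : 'I_n -> L, forall x, spanned s x >].
have exQ : exists n, Q n.
  by have [n [s sP]] := fin_h; exists n; apply/asboolP; exists s.
have [n /asboolP[s sP] min_n] := ex_minnP exQ.
have sqP x : spanned (fun i => s i ^+ q) x.
  have [r ->] := separable_frob_span charp e x sep_h.
  apply: big_ind => [|y z|u _]; last 1 first.
  - apply: spannedZ; have [c ->] := sP u.2.
    rewrite exprDn_pchar_sum //; exists (fun i => c i ^+ q).
    by apply: eq_bigr => i _; rewrite exprMn rmorphXn.
  - by exists (fun=> 0); rewrite big1 // => i _; rewrite rmorph0 mul0r.
  - exact: spannedD.
exists n, s; split=> // c d cd i; apply: contrapT => /eqP; rewrite -subr_eq0 => ci.
have {cd} : \sum_i h (c i - d i) * s i ^+ q = 0.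
  under eq_bigr => j _ do rewrite rmorphB mulrBl.
  by rewrite sumrB cd subrr.
set f := fun j => c j - d j; rewrite -/(f i) in ci * => f0.
case: n => [|n] in s sP min_n sqP c d i f ci f0 *; first by case: i {ci}.
(* A relation with nonzero coefficient at i allows [s i ^+ q] to be dropped, leaving a spanning
   family shorter than the minimal one. *)
have /min_n : Q n; last by rewrite ltnn.
apply/asboolP; exists (fun j => s (lift i j) ^+ q) => x.
have si : spanned (fun j => s (lift i j) ^+ q) (s i ^+ q).
  exists (fun j => - (f (lift i j) / f i)).
  apply: (@mulfI _ (h (f i))); first by rewrite fmorph_eq0.
  move/eqP: f0; rewrite (bigD1_ord i) //= addr_eq0 => /eqP->.
  rewrite mulr_sumr -sumrN; apply: eq_bigr => j _.
  rewrite rmorphN fmorph_div -[c _ - d _]/(f _).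
  by field; rewrite fmorph_eq0.
have [a ->] := sqP x; rewrite (bigD1_ord i) //=; apply: spannedD.
  exact: spannedZ.
by exists (fun j => a (lift i j)).
Qed.

Theorem frob_linear_extend (psi : K -> K) : frob_linear q psi ->
  exists psi' : L -> L, frob_linear q psi' /\ forall x, psi' (h x) = h (psi x).
Proof.
move=> lin; have [n [s [sP sqP free]]] := ex_frob_basis.
have /choice[coord coordP] := sqP.
(* The only possible value, since q-linearity takes [s i] out of [s i ^+ q]. *)
pose psi' x := \sum_i h (psi (coord x i)) * s i.
have psi'D x y : psi' (x + y) = psi' x + psi' y.
  have e1 : coord (x + y) =1 fun i => coord x i + coord y i.
    apply: free; rewrite -coordP.
    under [RHS]eq_bigr => j _ do rewrite rmorphD mulrDl.
    by rewrite big_split /= -!coordP.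
  rewrite -big_split; apply: eq_bigr => i _ /=.
  by rewrite e1 (frob_linearD lin) rmorphD mulrDl.
have psi'M x y : psi' (h x * y ^+ q) = h (psi x) * y.
  have [c yc] := sP y.
  have e1 : coord (h x * y ^+ q) =1 fun i => c i ^+ q * x.
    apply: free; rewrite -coordP yc exprDn_pchar_sum // mulr_sumr.
    by apply: eq_bigr => i _; rewrite exprMn rmorphM rmorphXn mulrA [h x * _]mulrC.
  rewrite [in RHS]yc mulr_sumr; apply: eq_bigr => i _.
  by rewrite e1 (frob_linearZ lin) rmorphM; ring.
have psi'0 : psi' 0 = 0 by apply: (addrI (psi' 0)); rewrite -psi'D !addr0.
have psi'sum r : psi' (\sum_(u <- r) h u.1 * u.2 ^+ q) = \sum_(u <- r) h (psi u.1) * u.2.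
  by rewrite (big_morph psi' psi'D psi'0); apply: eq_bigr => u _; exact: psi'M.
exists psi'; split; last by move=> x; rewrite -[h x]mulr1 -(expr1n _ q) psi'M mulr1.
split=> // x y; have [r ->] := separable_frob_span charp e y sep_h.
rewrite psi'sum !mulr_sumr.
under eq_bigr => u _ do rewrite mulrCA -exprMn.
rewrite -(big_map (fun u => (u.1, x * u.2)) predT (fun u => h u.1 * u.2 ^+ q)) psi'sum.
by rewrite big_map; apply: eq_bigr => u _ /=; ring.
Qed.

End ExtendFiniteSeparable.

Lemma finite_map_fintype (A B : comPzRingType) (f : A -> B) (I : finType) (s : I -> B) :
  (forall b, exists c : I -> A, b = \sum_i f (c i) * s i) -> finite_map f.
Proof.
move=> sP; exists #|I|, (fun k => s (enum_val k)) => b; have [c ->] := sP b.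
by exists (fun k => c (enum_val k)); rewrite (reindex _ (onW_bij _ (@enum_val_bij I))).
Qed.

(** Hom(F_* L, L) is a line over F_* L because the pairing phi0 (x y) is nondegenerate. The family
    [s] only spans, so its Gram matrix may be singular; what is shown is that the values of [phi] on
    [s] lie in its row space. *)
Lemma frob_linear_dual (L : fieldType) (q : nat) (phi0 phi : L -> L) :
  finite_map (fun a : L => a ^+ q) -> frob_linear q phi0 -> frob_linear q phi ->
  (exists x, phi0 x != 0) -> exists c, forall x, phi x = phi0 (c * x).
Proof.
move=> [n [s sP]] lin0 lin [x0 nz0].
pose G := \matrix_(i < n, j < n) phi0 (s i * s j); pose v := \row_(j < n) phi (s j).
have : (v <= G)%MS.
  rewrite submxE; apply/eqP/rowP => k; rewrite !mxE.
  (* A vector killed by the Gram matrix yields z with phi0 (L z) = 0, so z = 0, and the vector also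
     kills the values of [phi]. *)
  pose w j := cokermx G j k; pose z := \sum_j w j ^+ q * s j.
  have -> : \sum_j v 0 j * cokermx G j k = phi z.
    rewrite (frob_linear_sum lin); apply: eq_bigr => j _.
    by rewrite (frob_linearZ lin) mxE mulrC.
  suff -> : z = 0 by rewrite (frob_linear0 lin).
  have sz i : phi0 (s i * z) = 0.
    have /matrixP/(_ i k) := mulmx_coker G; rewrite !mxE => <-.
    rewrite mulr_sumr (frob_linear_sum lin0); apply: eq_bigr => j _.
    by rewrite mulrCA (frob_linearZ lin0) mxE mulrC.
  apply: contraNeq nz0 => z0; have [c e] := sP (x0 / z).
  rewrite -[x0](divfK z0) e mulr_suml (frob_linear_sum lin0) big1 // => i _.
  by rewrite -mulrA (frob_linearZ lin0) sz mulr0.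
case/submxP=> D vD; exists (\sum_i D 0 i ^+ q * s i) => x.
have sj j : phi (s j) = phi0 ((\sum_i D 0 i ^+ q * s i) * s j).
  have /rowP/(_ j) := vD; rewrite !mxE => ->.
  rewrite mulr_suml (frob_linear_sum lin0); apply: eq_bigr => i _.
  by rewrite -mulrA (frob_linearZ lin0) mxE.
have [c ->] := sP x; rewrite (frob_linear_sum lin) mulr_sumr (frob_linear_sum lin0).
by apply: eq_bigr => j _; rewrite (frob_linearZ lin) mulrCA (frob_linearZ lin0) sj.
Qed.

(** * F-finiteness of fields of fractions *)

Section FFinite.
Variables (L : fieldType) (p : nat) (charp : p \in [pchar L]).

Let p_gt0 : (0 < p)%N. Proof. exact: prime_gt0 (pcharf_prime charp). Qed.

Lemma F_finite_iter (e : nat) : F_finite p L -> finite_map (fun a : L => a ^+ (p ^ e)).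
Proof.
move=> [n [s sP]]; elim: e => [|e [m [t tP]]].
  by exists 1%N, (fun=> 1) => b; exists (fun=> b); rewrite big_ord1 mulr1.
apply: (@finite_map_fintype _ _ _ ('I_n * 'I_m)%type (fun u => t u.2 ^+ p * s u.1)) => b.
have [c ->] := sP b; have /choice[d dP] := fun i => tP (c i).
exists (fun u => d u.1 u.2).
rewrite -(pair_bigA _ (fun i j => d i j ^+ (p ^ e.+1) * (t j ^+ p * s i))) /=.
apply: eq_bigr => i _; rewrite {1}dP -[p in LHS]expn1.
rewrite exprDn_pchar_sum // mulr_suml.
by apply: eq_bigr => j _; rewrite expn1 exprMn -exprM -expnSr mulrA.
Qed.

Let pspan (I : finType) (t : I -> L) : set L :=
  [set x | exists c : I -> L, x = \sum_i c i ^+ p * t i].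

Let pspanD (I : finType) (t : I -> L) x y : pspan t x -> pspan t y -> pspan t (x + y).
Proof.
move=> [c ->] [d ->]; exists (fun i => c i + d i); rewrite -big_split.
apply: eq_bigr => i _ /=; rewrite -mulrDl exprDn_pchar //.
by rewrite (eq_pnat _ (pcharf_eq charp)) pnat_id // (pcharf_prime charp).
Qed.

Let pspanZ (I : finType) (t : I -> L) a x : pspan t x -> pspan t (a ^+ p * x).
Proof.
move=> [c ->]; exists (fun i => a * c i); rewrite mulr_sumr.
by apply: eq_bigr => i _; rewrite exprMn mulrA.
Qed.

Let pspan_sum (I : finType) (t : I -> L) (J : Type) (r : seq J) (F : J -> L) :
  (forall j, pspan t (F j)) -> pspan t (\sum_(j <- r) F j).
Proof.
move=> tF; apply: big_ind => //; last exact: pspanD.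
by exists (fun=> 0); rewrite big1 // => i _; rewrite expr0n eqn0Ngt p_gt0 mul0r.
Qed.

Let pspan_gen (I : finType) (t : I -> L) i : pspan t (t i).
Proof.
exists (fun j => (j == i)%:R); rewrite (bigD1 i) //= eqxx expr1n mul1r big1 ?addr0 //.
by move=> j /negbTE->; rewrite expr0n eqn0Ngt p_gt0 mul0r.
Qed.

Let pspanM (I : finType) (t : I -> L) x y : (forall i j, pspan t (t i * t j)) ->
  pspan t x -> pspan t y -> pspan t (x * y).
Proof.
move=> tt [c ->] [d ->]; rewrite mulr_suml; apply: pspan_sum => i.
rewrite mulr_sumr; apply: pspan_sum => j.
by rewrite mulrACA -exprMn; apply: pspanZ.
Qed.

(** The first clause makes the L^p-span of [t] closed under products. To adjoin x, its powers below
    p suffice, since higher ones are absorbed by coefficients that are p-th powers. *)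
Lemma pspan_generated (k : fieldType) (g : {rmorphism k -> L}) (s : seq L) :
  F_finite p k -> exists (I : finType) (t : I -> L),
  [/\ forall i j, pspan t (t i * t j), forall c, pspan t (g c) &
      forall x, x \in s -> pspan t x].
Proof.
move=> [n [a aP]]; elim: s => [|x s [I [t [tt tk ts]]]].
  have gP c : pspan (fun i => g (a i)) (g c).
    have [d ->] := aP c; exists (fun i => g (d i)); rewrite rmorph_sum.
    by apply: eq_bigr => i _; rewrite rmorphM rmorphXn.
  exists 'I_n, (fun i => g (a i)); split=> // i j; rewrite -rmorphM; exact: gP.
pose t' (u : I * 'I_p) := t u.1 * x ^+ u.2.
have t'P y m : pspan t y -> pspan t' (y * x ^+ m).
  move=> [c ->]; rewrite mulr_suml; apply: pspan_sum => i.
  rewrite -mulrA; apply: pspanZ; rewrite (divn_eq m p) exprD mulrCA exprM.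
  apply: pspanZ; have lt_mp : (m %% p < p)%N by rewrite ltn_mod.
  exact: (pspan_gen t' (i, Ordinal lt_mp)).
have tt' y : pspan t y -> pspan t' y by rewrite -[y in pspan t' y]mulr1 -(expr0 x); apply: t'P.
exists (I * 'I_p)%type, t'; split=> [u v|c|y].
- by rewrite mulrACA -exprD; exact: t'P.
- exact: tt'.
- rewrite inE => /orP[/eqP->|/ts/tt'//].
  rewrite -[x]mul1r -[x in 1 * x]expr1; apply: t'P.
  by rewrite -(rmorph1 g).
Qed.

(** Denominators move into the coefficients: a / b = (1 / b)^p (a b^(p-1)). *)
Theorem F_finite_fraction (k : fieldType) (A : comPzRingType)
  (f : {rmorphism k -> A}) (h : {rmorphism A -> L}) :
  F_finite p k -> finite_type_algebra f ->
  (forall x, exists a b, x = h a / h b) -> F_finite p L.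
Proof.
move=> Fk [s sP] frac_h.
have [I [t [tt tk ts]]] := pspan_generated (h \o f : {rmorphism k -> L}) (map h s) Fk.
apply: (@finite_map_fintype _ _ _ I t) => x; rewrite -/(pspan t x).
have hA a : pspan t (h a).
  apply: (sP (fun a => pspan t (h a))) => [c|b bs|b c|b c].
  - exact: tk.
  - by apply: ts; rewrite map_f.
  - by rewrite rmorphD; exact: pspanD.
  - by rewrite rmorphM; exact: pspanM.
have [a [b ->]] := frac_h x; have [->|b0] := eqVneq (h b) 0.
  by rewrite invr0 mulr0; have := hA 0; rewrite rmorph0.
have -> : h a / h b = (h b)^-1 ^+ p * h (a * b ^+ p.-1).
  rewrite rmorphM rmorphXn -{1}(prednK p_gt0) exprS exprVn; field.
  by rewrite expf_neq0.
exact: pspanZ.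
Qed.

End FFinite.

(** * Discrete valuation rings and tame extensions *)

(** Integer exponents for all of [L] encode that [L] is the field of fractions of [B], and make m
    the valuation of x. *)
Definition is_dvr (L : fieldType) (B : set L) (T : L) : Prop :=
  [/\ is_subring B, B T, T != 0, ~ B T^-1 &
    forall x, x != 0 -> exists (m : int) (u : L), [/\ B u, B u^-1 & x = u * T ^ m]].

Section Dvr.
Variables (L : fieldType) (B : set L) (T : L) (dvrB : is_dvr B T).

Lemma dvr_subring : is_subring B. Proof. by case: dvrB. Qed.
Lemma dvr_neq0 : T != 0. Proof. by case: dvrB. Qed.
Lemma dvrX n : B (T ^+ n). Proof. by case: dvrB => sB BT _ _ _; exact: subringX. Qed.
Local Hint Resolve dvr_subring dvr_neq0 dvrX : core.

Lemma dvrXz (m : int) : B (T ^ m) <-> 0 <= m.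
Proof.
case: m => n; first by split=> // _; exact: dvrX.
split=> // Bn; case: dvrB => _ _ _ []; rewrite NegzE in Bn.
suff -> : T^-1 = T ^ (- n.+1%:Z) * T ^+ n by exact: subringM.
by rewrite -exprnN exprS; field; rewrite dvr_neq0 expf_neq0 // dvr_neq0.
Qed.

Lemma dvr_unitM u x : u != 0 -> B u -> B u^-1 -> B (u * x) <-> B x.
Proof.
move=> u0 Bu Bu1; split=> [Bux|Bx]; last exact: subringM.
by rewrite -[x](mulKf u0); exact: subringM.
Qed.

Lemma dvr_unitXz u (m : int) : u != 0 -> B u -> B u^-1 -> B (u * T ^ m) <-> 0 <= m.
Proof. by move=> u0 Bu Bu1; rewrite dvr_unitM // dvrXz. Qed.

Lemma dvrP x : x != 0 -> exists (m : int) (u : L),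
  [/\ u != 0, B u, B u^-1 & x = u * T ^ m].
Proof.
move=> x0; case: dvrB => _ _ _ _ /(_ x x0)[m [u [Bu Bu1 e]]]; exists m, u; split=> //.
by apply: contra_neq x0 => u0; rewrite e u0 mul0r.
Qed.

(** Membership in [I] depends only on the valuation and is monotone in it, so [I] is T^-d B, where d
    + 1 is the least n with T^-n outside [I]. The assumption [I 1] makes d a natural number. *)
Lemma dvr_submodule (I : set L) : I 1 -> (forall x b, I x -> B b -> I (b * x)) ->
  (exists x, ~ I x) -> exists d : nat, forall z, I z <-> B (z * T ^+ d).
Proof.
move=> I1 IM [x nIx].
have I0 : I 0 by rewrite -(mul0r 1); apply: IM => //; exact: subring0.
have x0 : x != 0 by apply/eqP => x0; apply: nIx; rewrite x0.
have Iu u m : u != 0 -> B u -> B u^-1 -> I (u * T ^ m) <-> I (T ^ m).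
  move=> u0 Bu Bu1; split=> [|/IM]; last by apply.
  by move/IM => /(_ _ Bu1); rewrite mulKf.
have Imono (m n : int) : m <= n -> I (T ^ m) -> I (T ^ n).
  move=> le_mn /IM; move=> /(_ (T ^ (n - m))) h.
  by rewrite -[n](subrK m) expfzDr //; apply: h; apply/dvrXz; rewrite subr_ge0.
have ex_n : exists n, `[< ~ I (T ^ (- n%:Z)) >].
  have [m [u [u0 Bu Bu1 e]]] := dvrP x0; move: nIx; rewrite e Iu // => nI.
  exists `|m|%N; apply/asboolP; move=> hI; apply: nI; apply: Imono hI; lia.
have [n /asboolP nI min_n] := ex_minnP ex_n.
case: n => [|d] in nI min_n *; first by case: nI; rewrite oppr0 expr0z.
exists d => z; have [->|z0] := eqVneq z 0.
  by rewrite mul0r; split=> // _; exact: subring0.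
have [m [u [u0 Bu Bu1 ->]]] := dvrP z0; rewrite Iu //.
rewrite -mulrA -[T ^+ d]/(T ^ d%:Z) -expfzDr // dvr_unitXz //.
have Id : I (T ^ (- d%:Z)).
  by apply: contrapT => nId; have := min_n d; rewrite ltnn => F; apply/notF/F/asboolP.
split=> [Im|le_m].
  by rewrite leNgt; apply/negP => lt_m; apply: nI; apply: Imono Im; lia.
by apply: Imono Id; lia.
Qed.

Lemma frob_linear_order (q : nat) (phi : L -> L) : frob_linear q phi ->
  (exists x, phi x != 0) -> (forall b, B b -> B (phi b)) ->
  exists d : nat, forall z, (forall b, B b -> B (phi (z * b))) <-> B (z * T ^+ d).
Proof.
move=> lin [x nz] phiB.
apply: (dvr_submodule (I := [set z | forall b, B b -> B (phi (z * b))])).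
- by move=> b Bb; rewrite mul1r; exact: phiB.
- by move=> y b Iy Bb c Bc; rewrite mulrAC [_ * y]mulrC; apply: Iy; exact: subringM.
(* This element has image T^-1 under [phi], so the module is proper. *)
- exists ((T^-1 / phi x) ^+ q * x); case: (dvrB) => _ _ _ nT _ /(_ 1 (subring1 dvr_subring)).
  by rewrite mulr1 (frob_linearZ lin) divfK.
Qed.

End Dvr.

Lemma exprz_shift (L : fieldType) (z v T : L) (m k d : nat) : v != 0 -> T != 0 ->
  z * T ^ (m%:Z - k%:Z) = v^-1 ^+ d * (z * (v ^+ d * T ^+ m) / T ^+ k).
Proof.
move=> v0 T0; rewrite expfzDr // -exprnN exprVn -[T ^ m%:Z]/(T ^+ m); field.
by rewrite !expf_neq0.
Qed.

(** Choose i < q with n i = m mod q. If n i > m, then n i - m >= q, whence m <= n (q-1) - q =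
    (n-1)(q-1) - 1. *)
Lemma coprime_semigroup (n q m : nat) : (0 < n)%N -> (0 < q)%N -> coprime n q ->
  (n.-1 * q.-1 <= m)%N -> exists i j, m = (n * i + q * j)%N.
Proof.
move=> n0 q0 co le_m; have [u [v uv]] : exists u v, (n * u = v * q + 1)%N.
  have [u v e _] := egcdnP q n0; exists u, v; rewrite mulnC e.
  by move/eqP: co => ->.
pose i := ((m * u) %% q)%N; have lt_i : (i < q)%N by rewrite ltn_mod.
have e : (n * i = m %[mod q])%N.
  by rewrite modnMmr mulnCA uv mulnDr muln1 mulnA modnMDl.
exists i; have [le_i|lt_m] := leqP (n * i) m.
  have : (q %| m - n * i)%N by rewrite -eqn_mod_dvd // e.
  by case/dvdnP=> j ej; exists j; rewrite [(q * j)%N]mulnC -ej; lia.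
have : (q %| n * i - m)%N by rewrite -eqn_mod_dvd ?e // ltnW.
move/dvdn_leq; have le_i : (n * i <= n * q.-1)%N by rewrite leq_mul2l; lia.
have := congr1 (fun x => x * q.-1)%N (prednK n0); rewrite /= mulSn; lia.
Qed.

(** * The order of the extended map at a tame extension of discrete valuation rings *)

Section TameLocal.
Variables (K L : fieldType) (h : {rmorphism K -> L}).
Variables (A : set K) (B : set L) (t : K) (T v : L) (n q : nat).
Hypotheses (dvrA : is_dvr A t) (dvrB : is_dvr B T) (AB : forall a, A a -> B (h a)).
Hypotheses (Bv : B v) (Bv1 : B v^-1) (ht : h t = v * T ^+ n).
Hypotheses (n_gt0 : (0 < n)%N) (q_gt0 : (0 < q)%N) (co_nq : coprime n q).
Hypothesis residue_span : forall u, B u -> exists s : seq (K * L),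
  (forall x, x \in s -> A x.1 /\ B x.2) /\
  B ((u - \sum_(x <- s) h x.1 * x.2 ^+ q) / T).
Local Notation conductor := (n.-1 * q.-1)%N.

Let subA := dvr_subring dvrA.
Let subB := dvr_subring dvrB.
Let T0 := dvr_neq0 dvrB.
Let t0 := dvr_neq0 dvrA.

Let v0 : v != 0.
Proof. by apply/eqP => v0; move: t0; rewrite -(fmorph_eq0 h) ht v0 mul0r eqxx. Qed.

(* T ^+ conductor * B lies in the closure of the ring A[B^q]: every m >= conductor
   is the valuation of some h t ^+ i * T ^+ (q * j). *)
Lemma conductor_approx b N : B b -> exists (s : seq (K * L)) (r : L),
  [/\ forall x, x \in s -> A x.1 /\ B x.2, B r &
    T ^+ conductor * b = \sum_(x <- s) h x.1 * x.2 ^+ q + T ^+ (conductor + N) * r].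
Proof.
move=> Bb; elim: N => [|N [s [r [sAB Br ->]]]].
  by exists [::], b; rewrite big_nil add0r addn0.
have [i [j ij]] := coprime_semigroup n_gt0 q_gt0 co_nq (leq_addr N conductor).
have [s' [s'AB Br']] := residue_span (subringM subB Br (subringX subB i Bv1)).
set r' := _ / T in Br'.
exists (s ++ [seq (t ^+ i * x.1, T ^+ j * x.2) | x <- s']), (v ^+ i * r'); split.
- move=> x; rewrite mem_cat => /orP[/sAB//|/mapP[y /s'AB[Ay By] ->]] /=.
  by split; apply: subringM => //; exact: dvrX.
- by apply: subringM => //; exact: subringX.
rewrite big_cat -addrA; congr (_ + _); rewrite big_map /=.
have -> : \sum_(x <- s') h (t ^+ i * x.1) * (T ^+ j * x.2) ^+ q =
    h t ^+ i * T ^+ (q * j) * \sum_(x <- s') h x.1 * x.2 ^+ q.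
  rewrite mulr_sumr; apply: eq_bigr => x _.
  by rewrite rmorphM rmorphXn exprMn -exprM [(j * q)%N]mulnC mulrACA.
have -> : \sum_(x <- s') h x.1 * x.2 ^+ q = r * v^-1 ^+ i - r' * T.
  by rewrite /r' divfK // opprB addrC subrK.
rewrite ht exprMn -exprM addnS ij exprS !exprD exprVn; field.
by rewrite expf_neq0.
Qed.

Variables (psi : K -> K) (psi' : L -> L) (d : nat).
Hypotheses (lin : frob_linear q psi) (lin' : frob_linear q psi').
Hypothesis psi'h : forall x, psi' (h x) = h (psi x).
Hypothesis psi_order :
  forall z, (forall a, A a -> A (psi (z * a))) <-> A (z * t ^+ d).
Hypothesis psi'_bounded : exists2 g, g != 0 & forall b, B b -> B (g * psi' b).

Let psi'M x y : psi' (h x * y ^+ q) = y * h (psi x).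
Proof. by rewrite mulrC (frob_linearZ lin') psi'h. Qed.

(** On the approximating sums [psi'] is controlled, since [psi] maps t^-d A into A. The remainder is
    made divisible by (T^M)^q, from which [psi'] extracts a factor T^M that absorbs its
    denominators. *)
Lemma tame_order_upper z : B (z * h t ^+ d / T ^+ conductor) ->
  forall b, B b -> B (psi' (z * b)).
Proof.
move=> Bz b Bb; have [g g0 gB] := psi'_bounded.
have [M TM] : exists M, forall b, B b -> B (T ^+ M * psi' b).
  have [m [u [u0 Bu Bu1 e]]] := dvrP dvrB g0; exists `|m|%N => c Bc.
  have -> : T ^+ `|m|%N * psi' c = T ^ (`|m|%N%:Z - m) * u^-1 * (g * psi' c).
    have -> : T ^+ `|m|%N = T ^ (`|m|%N%:Z - m) * T ^ m by rewrite -expfzDr // subrK.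
    by rewrite e; field.
  apply: (subringM subB); last exact: gB.
  by apply: (subringM subB) => //; apply/(dvrXz dvrB); lia.
(* The precision q M provides the factor (T^M)^q, and n d makes up for the division by
   [h t ^+ d]. *)
have [s [r [sAB Br e]]] := conductor_approx (q * M + n * d) (subringM subB Bz Bb).
have -> : z * b = \sum_(x <- s) h (t ^- d * x.1) * x.2 ^+ q +
    (T ^+ M) ^+ q * (v^-1 ^+ d * T ^+ conductor * r).
  have ht0 : h t != 0 by rewrite fmorph_eq0.
  have -> : z * b = h (t ^- d) * (T ^+ conductor * (z * h t ^+ d / T ^+ conductor * b)).
    by rewrite fmorphV rmorphXn; field; rewrite !expf_neq0.
  rewrite e mulrDr mulr_sumr; congr (_ + _).
    by apply: eq_bigr => x _; rewrite rmorphM mulrA.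
  rewrite fmorphV rmorphXn ht !exprMn !exprD -!exprM [(M * q)%N]mulnC exprVn; field.
  by rewrite !expf_neq0.
rewrite (frob_linearD lin') (frob_linearZ lin'); apply: subringD => //; last first.
  apply: TM; do ![apply: (subringM subB)] => //; last exact: (dvrX dvrB).
  exact: subringX.
rewrite (frob_linear_sum lin') big_seq; apply: subring_sum => // x /sAB[Ax Bx].
rewrite psi'M; apply: subringM => //; apply: AB.
have /psi_order : A (t ^- d * t ^+ d) by rewrite mulVf ?expf_neq0 //; exact: subring1.
exact.
Qed.

(* The test element t ^+ (q - 1 - d) a / T ^+ q has valuation
   conductor - 1 - n d. *)
Lemma tame_order_lower z : (forall b, B b -> B (psi' (z * b))) ->
  B (z * h t ^+ d / T ^+ conductor).
Proof.
move=> psiB; apply: contrapT => nBz; set w := z * _ / _ in nBz.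
have w0 : w != 0 by apply/eqP => w0; apply: nBz; rewrite w0; exact: subring0.
have [m [u [u0 Bu Bu1 wE]]] := dvrP dvrB w0.
have m_lt0 : m < 0 by rewrite ltNge; apply/negP => m0; apply: nBz; rewrite wE dvr_unitXz.
have ht0 : h t != 0 by rewrite fmorph_eq0.
(* By [psi_order] the exponent d cannot be raised to d + 1. *)
have [a [Aa nAa]] : exists a, A a /\ ~ A (psi (t ^- d.+1 * a)).
  apply: contrapT => /forallNP no_a; case: (dvrA) => _ _ _ nt _; apply: nt.
  have -> : t^-1 = t ^- d.+1 * t ^+ d by rewrite exprS; field; rewrite t0 expf_neq0.
  by apply/psi_order => a Aa; apply: contrapT => nA; apply: (no_a a).
(* s lies in A but s / t = y does not, so s is a unit of A. *)
pose y := psi (t ^- d.+1 * a); pose s := t * y.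
have sE : s = psi (t ^- d * (t ^+ q.-1 * a)).
  rewrite /s -(frob_linearZ lin) -[in t ^+ q](prednK q_gt0); congr psi.
  by rewrite !exprS; field; rewrite t0 expf_neq0.
have As : A s.
  rewrite sE; have /psi_order : A (t ^- d * t ^+ d) by rewrite mulVf ?expf_neq0 //; exact: subring1.
  by apply; apply: subringM => //; exact: (dvrX dvrA).
have As1 : A s^-1 /\ s != 0.
  have s0 : s != 0.
    rewrite mulf_neq0 //; apply/eqP => y0; apply: nAa; rewrite -/y y0; exact: subring0.
  split=> //; have [k [c [c0 Ac Ac1 e]]] := dvrP dvrA s0.
  have k_ge0 : 0 <= k by rewrite -(dvr_unitXz dvrA k c0 Ac Ac1) -e.
  suff -> : s^-1 = c^-1 by [].
  rewrite e; suff -> : k = 0 by rewrite expr0z mulr1.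
  apply/eqP; rewrite eq_le k_ge0 andbT leNgt; apply/negP => k_gt0; apply: nAa.
  rewrite -/y (_ : y = c * t ^ (k - 1)); first by apply/(dvr_unitXz dvrA) => //; lia.
  by apply: (mulfI t0); rewrite -/s e expfzDr // exprN1; field.
have [As' s0] := As1.
(* The cofactor that turns z into the test element; it lies in B because m <= -1. *)
pose b := u^-1 * T ^ (- m - 1) * v ^+ q.-1 * h a.
have Bb : B b.
  do ![apply: (subringM subB)] => //; last exact: AB.
    by apply/(dvrXz dvrB); lia.
  exact: subringX.
have : B (psi' (z * b)) by exact: psiB.
have cond : (conductor + q = n * q.-1 + 1)%N.
  by rewrite -[in RHS](prednK n_gt0) mulSn -[in LHS](prednK q_gt0) /=; lia.
have -> : z * b = h (t ^- d * (t ^+ q.-1 * a)) * (T^-1) ^+ q.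
  have zE : z = w * T ^+ conductor / h t ^+ d.
    by rewrite /w; field; rewrite !expf_neq0.
  have -> : h (t ^- d * (t ^+ q.-1 * a)) = h t ^+ q.-1 * h a / h t ^+ d.
    by rewrite !rmorphM fmorphV !rmorphXn; ring.
  have eT : T ^ m * T ^ (- m - 1) = T^-1.
    by rewrite -expfzDr // (_ : m + _ = -1) ?exprN1 //; lia.
  have eC : T ^+ conductor * T^-1 = T ^+ (n * q.-1) * T^-1 ^+ q.
    apply: (@mulIf _ (T ^+ q.+1)); first by rewrite expf_neq0.
    have -> : T ^+ conductor / T * T ^+ q.+1 = T ^+ (conductor + q).
      by rewrite exprS exprD; field.
    by rewrite cond exprVn exprD [T ^+ q.+1]exprS expr1; field; rewrite expf_neq0.
  have -> : z * b = (T ^ m * T ^ (- m - 1)) * T ^+ conductor * v ^+ q.-1 * h a / h t ^+ d.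
    by rewrite zE wE /b; field; rewrite u0 expf_neq0.
  rewrite eT [T^-1 * _]mulrC eC ht [in RHS]exprMn -exprM.
  by rewrite !exprVn; field; rewrite !expf_neq0 // mulf_neq0 // expf_neq0.
(* The image of z b is T^-1 [h s]; dividing by the unit [h s] would put T^-1 in B. *)
rewrite psi'M -sE => /(subringM subB (AB As')).
rewrite mulrC -mulrA -rmorphM mulfV // rmorph1 mulr1.
by case: (dvrB) => _ _ _ nT _.
Qed.

End TameLocal.

(** * Frobenius-linear maps of a domain and of its field of fractions *)

Section LocalFrobenius.
Variables (A : idomainType) (L : fieldType) (g : {rmorphism A -> L}) (q : nat).
Hypothesis inj_g : injective g.
Hypothesis frac_g : forall x, exists a b, b != 0 /\ x = g a / g b.
Hypothesis q_gt0 : (0 < q)%N.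

Let subB : is_subring (range g). Proof. exact: subring_range. Qed.

Let g_eq0 a : (g a == 0) = (a == 0).
Proof. by rewrite -(inj_eq inj_g) rmorph0. Qed.

(** Since a / b = (1 / b)^q (a b^(q-1)), the value at a / b has to be phi (a b^(q-1)) / b. *)
Lemma frob_linear_fraction (phi : A -> A) : frob_linear q phi ->
  exists phi' : L -> L, frob_linear q phi' /\ forall a, phi' (g a) = g (phi a).
Proof.
move=> lin.
have /choice[u uP] : forall x, exists u : A * A, u.2 != 0 /\ x = g u.1 / g u.2.
  by move=> x; have [a [b ab]] := frac_g x; exists (a, b).
pose phi' x := g (phi ((u x).1 * (u x).2 ^+ q.-1)) / g (u x).2.
have phi'E a b : b != 0 -> phi' (g a / g b) = g (phi (a * b ^+ q.-1)) / g b.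
  move=> b0; rewrite /phi'; set x := g a / g b; have [c0 e] := uP x.
  set c := (u x).1 in e *; set d := (u x).2 in e c0 *.
  have cross : c * b = a * d.
    apply: inj_g; rewrite !rmorphM; apply: (@mulIf _ (g d * g b)^-1).
      by rewrite invr_eq0 mulf_neq0 ?g_eq0.
    transitivity (g c / g d); first by field; rewrite !g_eq0 b0 c0.
    by rewrite -e /x; field; rewrite !g_eq0 b0 c0.
  apply: (@mulIf _ (g (d * b))); first by rewrite g_eq0 mulf_neq0.
  transitivity (g (phi (b ^+ q * (c * d ^+ q.-1)))).
    by rewrite (frob_linearZ lin) !rmorphM; field; rewrite g_eq0.
  transitivity (g (phi (d ^+ q * (a * b ^+ q.-1)))); last first.
    by rewrite (frob_linearZ lin) !rmorphM; field; rewrite g_eq0.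
  congr (g (phi _)); rewrite -(prednK q_gt0) !exprS.
  transitivity (c * b * (b ^+ q.-1 * d ^+ q.-1)); first by rewrite /=; ring.
  by rewrite cross /=; ring.
exists phi'; split; last first.
  by move=> a; rewrite -[g a]divr1 -(rmorph1 g) phi'E ?oner_eq0 // expr1n mulr1 rmorph1 divr1.
split=> x y.
  have [a [b [b0 ->]]] := frac_g x; have [c [d [d0 ->]]] := frac_g y.
  have -> : g a / g b + g c / g d = g (a * d + c * b) / g (b * d).
    by rewrite rmorphD !rmorphM; field; rewrite !g_eq0 b0 d0.
  rewrite !phi'E ?mulf_neq0 //.
  have -> : (a * d + c * b) * (b * d) ^+ q.-1 =
      d ^+ q * (a * b ^+ q.-1) + b ^+ q * (c * d ^+ q.-1).
    by rewrite -(prednK q_gt0) !exprS exprMn /=; ring.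
  rewrite (frob_linearD lin) !(frob_linearZ lin) rmorphD !rmorphM.
  by field; rewrite !g_eq0 b0 d0.
have [a [b [b0 ->]]] := frac_g x; have [c [d [d0 ->]]] := frac_g y.
have -> : (g a / g b) ^+ q * (g c / g d) = g (a ^+ q * c) / g (b ^+ q * d).
  by rewrite !rmorphM !rmorphXn expr_div_n; field; rewrite !g_eq0 d0 expf_neq0 ?g_eq0.
rewrite !phi'E ?mulf_neq0 ?expf_neq0 //.
have -> : a ^+ q * c * (b ^+ q * d) ^+ q.-1 = (a * b ^+ q.-1) ^+ q * (c * d ^+ q.-1).
  by rewrite !exprMn -!exprM [(q.-1 * q)%N]mulnC; ring.
rewrite (frob_linearZ lin) !rmorphM -[in g (b ^+ q)](prednK q_gt0) exprS rmorphM.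
by field; rewrite !g_eq0 b0 d0 expf_neq0.
Qed.

Hypothesis noethB : noetherian (range g).

(** If every power of t divided a, then t^-1 would be almost integral, hence integral over A.
    Multiplying its equation by a power of t gives t^-1 in A, although t is not a unit. *)
Lemma uniformizer_decomposition (t a : A) : uniformizer t -> a != 0 ->
  exists n u, u \is a GRing.unit /\ a = u * t ^+ n.
Proof.
move=> [t0 tP] a0; apply: contrapT => no.
have nt : t \isn't a GRing.unit by apply/tP; exists 1; rewrite mulr1.
have dvd n : exists b, a = t ^+ n * b.
  elim: n => [|n [b ab]]; first by exists a; rewrite mul1r.
  have [ub|/tP[c bc]] := boolP (b \is a GRing.unit).
    by case: no; exists n, b; rewrite mulrC.
  by exists c; rewrite exprSr -mulrA -bc.
have gt0 : g t != 0 by rewrite g_eq0.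
have [||[|n] [c [Rc e]]] := noetherian_integral (x := g a) (theta := (g t)^-1) noethB.
- by rewrite g_eq0.
- move=> k; have [b ->] := dvd k; exists b => //.
  by rewrite rmorphM rmorphXn exprVn mulrAC mulfV ?mul1r // expf_neq0.
- by have := oner_neq0 L; rewrite -(expr0 (g t)^-1) e big_ord0 eqxx.
have [b _ bt] : range g (g t)^-1.
  have -> : (g t)^-1 = \sum_(i < n.+1) c i * g (t ^+ (n - i)).
    transitivity ((g t)^-1 ^+ n.+1 * g t ^+ n).
      by rewrite exprVn exprS; field; rewrite gt0 expf_neq0.
    rewrite e mulr_suml; apply: eq_bigr => i _.
    rewrite -[in g t ^+ n](subnK (ltn_ord i : (i <= n)%N)) exprD rmorphXn exprVn.
    by field; rewrite expf_neq0.
  by apply: subring_sum => // i _; apply: subringM => //; exists (t ^+ (n - i)).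
move/negP: nt; apply; apply/unitrPr; exists b.
by apply: inj_g; rewrite rmorphM bt rmorph1 mulfV.
Qed.

(** The exponent chosen by [ord] may refer to another uniformizer s, but s and t are associates. *)
Lemma ordP (t a : A) : uniformizer t -> a != 0 ->
  exists u, u \is a GRing.unit /\ a = u * t ^+ ord a.
Proof.
move=> unif_t a0; rewrite /ord; case: xgetP => [n _ [s [u [[s0 sP] uu ->]]]|no].
  have [t0 tP] := unif_t.
  have ns : s \isn't a GRing.unit by apply/sP; exists 1; rewrite mulr1.
  have nt : t \isn't a GRing.unit by apply/tP; exists 1; rewrite mulr1.
  have [[b sb] [c tc]] := ((iffLR (tP s)) ns, (iffLR (sP t)) nt).
  have ub : b \is a GRing.unit.
    apply/unitrPr; exists c; apply: (mulfI t0).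
    by rewrite mulrA -sb -tc mulr1.
  by exists (u * b ^+ n); rewrite unitrM uu unitrX // sb exprMn; split=> //; ring.
have [n [u [uu e]]] := uniformizer_decomposition unif_t a0.
by case: (no n); exists t, u.
Qed.

Lemma uniformizer_dvr (t : A) : uniformizer t -> is_dvr (range g) (g t).
Proof.
move=> unif_t; have [t0 tP] := unif_t.
have nt : t \isn't a GRing.unit by apply/tP; exists 1; rewrite mulr1.
split=> //.
- by rewrite g_eq0.
- move=> [b _ bt]; move/negP: nt; apply; apply/unitrPr; exists b.
  by apply: inj_g; rewrite rmorphM bt rmorph1 mulfV // g_eq0.
move=> x x0; have [a [b [b0 e]]] := frac_g x; rewrite e in x0 *.
have a0 : a != 0 by apply: contra_neq x0 => ->; rewrite rmorph0 mul0r.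
have [n [u [uu ->]]] := uniformizer_decomposition unif_t a0.
have [m [v [vu ->]]] := uniformizer_decomposition unif_t b0.
exists (n%:Z - m%:Z), (g (u / v)); split; first by exists (u / v).
  by exists (v / u) => //; rewrite !rmorphM !rmorphV // invfM invrK mulrC.
rewrite [g (u / v)]rmorphM rmorphV // expfzDr ?g_eq0 // !rmorphM !rmorphXn invfM.
rewrite -exprnN -[g t ^ n%:Z]/(g t ^+ n); field.
by rewrite expf_neq0 !g_eq0 ?(proj1 unif_t) //; apply: contraTneq vu => ->; rewrite unitr0.
Qed.

Hypothesis fin_q : finite_map (fun a : L => a ^+ q).
Variables (phi : A -> A) (phi' : L -> L) (t : A).
Hypotheses (unif_t : uniformizer t) (lin' : frob_linear q phi').
Hypotheses (phi'E : forall a, phi' (g a) = g (phi a)) (phi'_neq0 : exists x, phi' x != 0).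

Let dvrB := uniformizer_dvr unif_t.

Let frob_linear_ext0 (f : L -> L) : frob_linear q f -> (forall a, f (g a) = 0) ->
  forall x, f x = 0.
Proof.
move=> linf f0 x; have [a [b [b0 ->]]] := frac_g x.
have -> : g a / g b = (g b)^-1 ^+ q * g (a * b ^+ q.-1).
  rewrite rmorphM rmorphXn exprVn -[in X in X^-1 * _](prednK q_gt0) exprS.
  by field; rewrite g_eq0 b0 expf_neq0 ?g_eq0.
by rewrite (frob_linearZ linf) f0 mulr0.
Qed.

(** If z is in the module, phi' (z _) restricts to a q-linear map of A, hence is Phi (d _) for some
    d in A. The extension of Phi to L is not 0, which forces z c = d. *)
Lemma generator_order (Phi : A -> A) (c : A) (z : L) : frob_generator q Phi ->
  (forall a, phi a = Phi (c * a)) ->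
  (forall b, range g b -> range g (phi' (z * b))) <-> range g (z * g c).
Proof.
move=> [linP genP] phiP; have [P' [linP' P'E]] := frob_linear_fraction linP.
have phi'P x : phi' x = P' (g c * x).
  apply/eqP; rewrite -subr_eq0; apply/eqP; move: x.
  apply: (frob_linear_ext0 (f := fun x => phi' x - P' (g c * x))).
    split=> x y; first by rewrite mulrDr (frob_linearD lin') (frob_linearD linP'); ring.
    by rewrite (frob_linearZ lin') mulrCA (frob_linearZ linP') mulrBr.
  by move=> a; rewrite phi'E phiP -rmorphM P'E subrr.
split=> [zB|[d _ dE] b [a _ <-]]; last first.
  by rewrite phi'P mulrA [g c * z]mulrC -dE -rmorphM P'E; exists (Phi (d * a)).
have /choice[f fE] : forall a, exists b, g b = phi' (z * g a).
  by move=> a; have [|b _ be] := zB (g a); [exists a|exists b].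
have linf : frob_linear q f.
  split=> x y; apply: inj_g; rewrite ?rmorphD ?rmorphM !fE.
    by rewrite rmorphD mulrDr (frob_linearD lin').
  by rewrite rmorphM rmorphXn mulrCA (frob_linearZ lin').
have [d dP] := genP f linf.
suff -> : z * g c = g d by exists d.
apply/eqP; rewrite -subr_eq0; apply/negP => /negP nz.
have [x /negP[]] := phi'_neq0; apply/eqP.
have P'0 : forall y, P' ((z * g c - g d) * y) = 0.
  apply: (frob_linear_ext0 (f := fun y => P' ((z * g c - g d) * y))).
    exact: frob_linear_comp_mul.
  move=> a; rewrite mulrBl (frob_linearB linP') -rmorphM P'E -dP fE phi'P.
  by rewrite mulrCA mulrA subrr.
by rewrite phi'P -(P'0 ((z * g c - g d)^-1 * (g c * x))) mulVKf.
Qed.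

(** The generator is phi' (t^-d _) with d the order of phi'. Over L any q-linear map is phi' (z _),
    and if it preserves A then z is in t^-d A. *)
Lemma ex_frob_generator : exists (Phi : A -> A) (c : A),
  frob_generator q Phi /\ forall a, phi a = Phi (c * a).
Proof.
have [|d dP] := frob_linear_order dvrB lin' phi'_neq0.
  by move=> _ [a _ <-]; rewrite phi'E; exists (phi a).
have gt0 : g t != 0 by rewrite g_eq0; case: unif_t.
have : forall b, range g b -> range g (phi' (g t ^- d * b)).
  by apply/dP; rewrite mulVf ?expf_neq0 //; exact: subring1.
move=> PhiB; have /choice[Phi PhiE] : forall a, exists b, g b = phi' (g t ^- d * g a).
  by move=> a; have [|b _ be] := PhiB (g a); [exists a|exists b].
exists Phi, (t ^+ d); split; last first.
  move=> a; apply: inj_g; by rewrite PhiE rmorphM rmorphXn mulKf ?expf_neq0 //.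
split.
  split=> x y; apply: inj_g; rewrite ?rmorphD ?rmorphM !PhiE.
    by rewrite rmorphD mulrDr (frob_linearD lin').
  by rewrite rmorphM rmorphXn mulrCA (frob_linearZ lin').
move=> f linf; have [f' [linf' f'E]] := frob_linear_fraction linf.
have [z zP] := frob_linear_dual fin_q lin' linf' phi'_neq0.
have /dP[c _ cE] : forall b, range g b -> range g (phi' (z * b)).
  by move=> _ [a _ <-]; rewrite -zP f'E; exists (f a).
exists c => a; apply: inj_g; rewrite -f'E zP PhiE rmorphM cE.
by congr phi'; field; rewrite expf_neq0.
Qed.

(** [D] copies the definition of [D_psi]. The module on the left does not mention Phi or c, so the
    choice is immaterial, and the existence of a generator rules out the default 0. *)
Theorem frob_order_xget z :
  let D := xget 0%N [set n | exists (Phi : A -> A) (c : A),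
    [/\ frob_generator q Phi, forall a, phi a = Phi (c * a) & n = ord c]] in
  (forall b, range g b -> range g (phi' (z * b))) <-> range g (z * g t ^+ D).
Proof.
move=> /=; case: xgetP => [n _ [Phi [c [genP phiP ->]]]|no]; last first.
  have [Phi [c [genP phiP]]] := ex_frob_generator.
  by case: (no (ord c)); exists Phi, c.
rewrite (generator_order z genP phiP).
have c0 : c != 0.
  apply/eqP => c0; have [x /negP[]] := phi'_neq0; apply/eqP; move: x.
  apply: (frob_linear_ext0 lin') => a; rewrite phi'E phiP c0 mul0r.
  by case: genP => linP _; rewrite (frob_linear0 linP) rmorph0.
have [u [uu cE]] := ordP unif_t c0; rewrite {1}cE rmorphM rmorphXn mulrCA.
apply: dvr_unitM; rewrite ?g_eq0; first exact: dvrB.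
- by apply: contraTneq uu => ->; rewrite unitr0.
- by exists u.
- by exists u^-1 => //; rewrite rmorphV.
Qed.

End LocalFrobenius.

(** * Finiteness of function fields and bounded denominators *)

Lemma algebraic_inv (K L : fieldType) (h : {rmorphism K -> L}) (f : {poly K}) (x : L) :
  f != 0 -> x != 0 -> root (map_poly h f) x ->
  exists g : {poly K}, x^-1 = (map_poly h g).[x].
Proof.
move=> + x0; elim/poly_ind: f => [|f c IHf]; first by rewrite eqxx.
rewrite /root rmorphD rmorphM /= map_polyX map_polyC /= hornerD hornerM hornerX hornerC.
have [->|c0] := eqVneq c 0.
  rewrite polyC0 rmorph0 !addr0 => f0; rewrite mulf_eq0 (negbTE x0) orbF => rx; apply: IHf rx.
  by apply: contraNneq f0 => ->; rewrite mul0r.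
move=> _; rewrite addr_eq0 => /eqP e; exists (- (c^-1) *: f).
rewrite map_polyZ hornerZ rmorphN fmorphV; apply: (mulIf x0).
by rewrite mulVf // -mulrA e mulrNN mulVf // fmorph_eq0.
Qed.

Section FiniteFractions.
Variables (A B : comPzRingType) (K L : fieldType).
Variables (f : A -> B) (a : A -> K) (b : {rmorphism B -> L}) (h : {rmorphism K -> L}).

(** The K-span of the module generators of B is already closed under products, and the inverse of an
    algebraic element is a polynomial in it; so this span is all of L. *)
Lemma finite_map_fraction : (forall x, b (f x) = h (a x)) -> finite_map f ->
  separable_ext h -> (forall x, exists y z, b z != 0 /\ x = b y / b z) -> finite_map h.
Proof.
move=> fE [n [s sP]] sep frac; exists n, (fun i => b (s i)).
pose M : set L := [set x | exists c : 'I_n -> K, x = \sum_i h (c i) * b (s i)].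
have MD x y : M x -> M y -> M (x + y).
  move=> [c ->] [d ->]; exists (fun i => c i + d i); rewrite -big_split.
  by apply: eq_bigr => i _; rewrite rmorphD mulrDl.
have MZ c x : M x -> M (h c * x).
  move=> [d ->]; exists (fun i => c * d i); rewrite mulr_sumr.
  by apply: eq_bigr => i _; rewrite rmorphM mulrA.
have M_sum (I : Type) (r : seq I) (F : I -> L) :
    (forall i, M (F i)) -> M (\sum_(i <- r) F i).
  move=> MF; apply: big_ind => //.
  by exists (fun=> 0); rewrite big1 // => i _; rewrite rmorph0 mul0r.
have MB y : M (b y).
  have [c ->] := sP y; exists (fun i => a (c i)); rewrite rmorph_sum.
  by apply: eq_bigr => i _; rewrite rmorphM fE.
have MM x y : M x -> M y -> M (x * y).
  move=> [c ->] [d ->]; rewrite mulr_suml; apply: (M_sum) => i.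
  rewrite mulr_sumr; apply: (M_sum) => j; rewrite mulrACA -rmorphM; apply: (MZ).
  by rewrite -rmorphM; exact: MB.
move=> x; have [y [z [z0 ->]]] := frac x; apply: MM; first exact: MB.
have [g sep_g root_z] := sep (b z).
have [u ->] := algebraic_inv (separable_poly_neq0 sep_g) z0 root_z.
rewrite horner_coef; apply: (M_sum) => i; rewrite coef_map; apply: (MZ).
by rewrite -rmorphXn; exact: MB.
Qed.

End FiniteFractions.

Lemma common_multiplier (L : fieldType) (B : set L) (I : eqType) (s : seq I)
  (P : I -> L -> Prop) : is_subring B ->
  (forall i, exists g, [/\ g != 0, B g & P i g]) ->
  (forall i g b, B b -> P i g -> P i (b * g)) ->
  exists g, [/\ g != 0, B g & forall i, i \in s -> P i g].
Proof.
move=> subB exP mulP; elim: s => [|i s [g [g0 Bg sP]]].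
  by exists 1; split=> //; [exact: oner_neq0|exact: subring1].
have [g' [g'0 Bg' Pg']] := exP i; exists (g * g'); split; first by rewrite mulf_neq0.
  exact: subringM.
move=> j; rewrite inE => /orP[/eqP->|/sP Pj]; first exact: mulP.
by rewrite mulrC; exact: mulP.
Qed.

Section BoundedDenominators.
Variables (A C : comPzRingType) (K L : fieldType).
Variables (f : A -> C) (a : {rmorphism A -> K}) (b : {rmorphism C -> L}).
Variables (h : {rmorphism K -> L}) (p e : nat) (B : set L).
Local Notation q := (p ^ e)%N.
Hypotheses (charp : p \in [pchar K]) (sep_h : separable_ext h).
Hypotheses (fE : forall x, b (f x) = h (a x)) (fin_f : finite_map f).
Hypothesis frac_a : forall x, exists y z, a z != 0 /\ x = a y / a z.
Hypotheses (subB : is_subring B) (bB : forall c, B (b c)).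
Hypothesis frac_B : forall x, exists y z, [/\ B y, B z, z != 0 & x = y / z].
Hypothesis loc_B : forall x, B x -> exists y z, [/\ B (b z)^-1, b z != 0 & x = b y / b z].
Variables (psiA : A -> A) (psi : K -> K) (psi' : L -> L).
Hypotheses (lin' : frob_linear q psi') (psiE : forall x, psi (a x) = a (psiA x)).
Hypothesis psi'h : forall x, psi' (h x) = h (psi x).

Let q_gt0 : (0 < q)%N.
Proof. by rewrite expn_gt0 (prime_gt0 (pcharf_prime charp)). Qed.

Let invX (F : fieldType) (x y : F) : y != 0 -> x / y = y^-1 ^+ q * (x * y ^+ q.-1).
Proof.
move=> y0; rewrite exprVn -[in y ^- q](prednK q_gt0) exprS; field.
by rewrite y0 expf_neq0.
Qed.

(** Write a generator of C as a sum of h(u1) u2^q and u1 = y / z. On r h(u1) u2^q, [psi'] gives u2 /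
    z times an element from C, so the denominator does not depend on r. Finitely many denominators
    are cleared by g; passing from C to B only multiplies the values by inverses of units. *)
Lemma frob_bounded_denominators : exists2 g, g != 0 & forall x, B x -> B (g * psi' x).
Proof.
have [n [s sP]] := fin_f.
have term (u : K * L) : exists g, [/\ g != 0, B g &
    forall r, B (g * psi' (h (a r) * (h u.1 * u.2 ^+ q)))].
  case: u => u1 u2 /=; have [y [z [z0 u1E]]] := frac_a u1.
  have hz0 : h (a z) != 0 by rewrite fmorph_eq0.
  have [w [g [Bw Bg g0 wE]]] := frac_B (u2 / h (a z)); exists g; split=> // r.
  have -> : h (a r) * (h u1 * u2 ^+ q) =
      (u2 / h (a z)) ^+ q * h (a (r * y * z ^+ q.-1)).
    rewrite u1E (invX _ z0) !rmorphM !rmorphXn fmorphV !exprVn exprMn -exprVn.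
    by rewrite exprVn; ring.
  rewrite (frob_linearZ lin') psi'h psiE wE mulrA [g * _]mulrC divfK //.
  by rewrite -fE; apply: subringM.
have gens (i : 'I_n) : exists g, [/\ g != 0, B g &
    forall r, B (g * psi' (h (a r) * b (s i)))].
  have [l sE] := separable_frob_span charp e (b (s i)) sep_h.
  have [|g [g0 Bg lP]] := common_multiplier l subB term.
    by move=> u g c Bc Pg r; rewrite -mulrA; apply: subringM.
  exists g; split=> // r; rewrite sE mulr_sumr (frob_linear_sum lin') mulr_sumr big_seq.
  by apply: subring_sum => // u /lP.
have [|g [g0 Bg sg]] := common_multiplier (enum 'I_n) subB gens.
  by move=> u g c Bc Pg r; rewrite -mulrA; apply: subringM.
exists g => // x /loc_B[y [z [Bz z0 ->]]].
rewrite (invX _ z0) (frob_linearZ lin') mulrCA -rmorphXn -rmorphM; apply: subringM => //.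
have [c ->] := sP (y * z ^+ q.-1).
rewrite rmorph_sum (frob_linear_sum lin') mulr_sumr; apply: subring_sum => // i _.
by rewrite rmorphM fE; apply: sg; rewrite mem_enum.
Qed.

End BoundedDenominators.

(** * Integral schemes and their function fields *)

Section Sheaf.
Variable X : ringedSpace.
Implicit Types U V W : opens X.

Lemma sect_ext U (I : Type) (V : I -> opens X) (h : forall i, V i `<=` U)
  (s t : sect U) : U `<=` \bigcup_i V i -> (forall i, res (h i) s = res (h i) t) -> s = t.
Proof.
move=> cov e; have [|r [_ uniq_r]] := @rs_glue X U I V h cov (fun i => res (h i) s).
  move=> i j W hi hj; rewrite (rs_res_comp _ _ (subset_trans hi (h i))).
  by rewrite (rs_res_comp _ _ (subset_trans hi (h i))).
by rewrite -(uniq_r s) // -(uniq_r t).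
Qed.

Lemma sect_local U (s t : sect U) :
  (forall x, oset U x -> exists V (h : V `<=` U), oset V x /\ res h s = res h t) ->
  s = t.
Proof.
move=> loc.
have /choice[V VP] : forall x : {x | oset U x}, exists V,
    exists h : V `<=` U, oset V (sval x) /\ res h s = res h t.
  by case=> x Ux; have [V [h e]] := loc x Ux; exists V, h.
pose h x : V x `<=` U := projT1 (cid (VP x)).
apply: (@sect_ext U _ V h) => [x Ux|x].
  by exists (exist _ x Ux) => //; case: (VP (exist _ x Ux)) => ? [].
have [h' [_ e]] := VP x.
by rewrite (res_irr (h x) h') e (res_irr h' (h x)).
Qed.

Lemma sect_empty U (s t : sect U) : (forall x, ~ oset U x) -> s = t.
Proof. by move=> U0; apply: sect_local => x /U0. Qed.

Lemma germ_inv_basic U x (hx : oset U x) (f : sect U) :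
  basic_set f x <-> invertible (germ hx f).
Proof.
split=> [[hx' i]|i]; last by exists hx.
by rewrite (Prop_irrelevance hx hx').
Qed.

Lemma basic_set_res U V (h : V `<=` U) (f : sect U) x : oset V x ->
  basic_set (res h f) x <-> basic_set f x.
Proof.
by move=> Vx; rewrite (germ_inv_basic Vx) (germ_inv_basic (h x Vx)) (germ_res h (h x Vx)).
Qed.

End Sheaf.

Section IntegralScheme.
Variable X : integralScheme.
Implicit Types (U V W : opens X) (x y z w : X).

Lemma sect_oner_neq0 U x : oset U x -> (1 : sect U) <> 0.
Proof. by move=> Ux; case: (int_domain (ex_intro _ x Ux)). Qed.

Lemma sect_integral U (a b : sect U) : a * b = 0 -> a = 0 \/ b = 0.
Proof.
have [[x Ux]|U0] := pselect (exists x, oset U x).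
  by have [_] := int_domain (ex_intro _ x Ux); exact.
by move=> _; left; apply: sect_empty => x Ux; apply: U0; exists x.
Qed.

Lemma sect_expf_eq0 U (a : sect U) n x : oset U x -> a ^+ n = 0 -> a = 0.
Proof.
move=> Ux; elim: n => [/(sect_oner_neq0 Ux)//|n IHn].
by rewrite exprS => /sect_integral[|/IHn].
Qed.

(** Over disjoint U and V the sections 1 and 0 would glue to a nontrivial idempotent of a domain. *)
Lemma opens_meet U V x y : oset U x -> oset V y -> exists z, oset U z /\ oset V z.
Proof.
move=> Ux Vy; apply: contrapT => /forallNP disj.
pose W : opens X := Opens (openU (opens_open U) (opens_open V)).
pose F (b : bool) := if b then U else V.
have h b : F b `<=` W by case: b => z; [left|right].
have cov : W `<=` \bigcup_b F b by move=> z [Uz|Vz]; [exists true|exists false].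
pose s (b : bool) : sect (F b) := match b with true => 1 | false => 0 end.
have [|e [eP _]] := rs_glue h cov (s := s).
  move=> i j W' hi hj; have [ij|ij] := eqVneq i j.
    by case: j / ij hj => hj; exact: res_irr.
  apply: sect_empty => z W'z; apply: (disj z); move: (hi _ W'z) (hj _ W'z) ij.
  by case: i {hi}; case: j {hj}.
have : e * (1 - e) = 0.
  apply: (@sect_ext _ _ _ _ h) => // b.
  rewrite rmorphM rmorphB rmorph1 rmorph0 eP.
  by case: b; rewrite /= ?subrr ?mulr0 ?mul0r.
case/sect_integral => e0.
  by have := eP true; rewrite e0 rmorph0 => /esym; exact: (@sect_oner_neq0 U x).
have := congr1 (res (h false)) e0; rewrite rmorphB rmorph1 eP rmorph0 /= subr0.
exact: (@sect_oner_neq0 V y).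
Qed.

(** Over an empty D(a) the section 1 vanishes, so the localization axiom makes a nilpotent. *)
Lemma affine_basic_nonempty U (a : sect U) : affine U -> a <> 0 ->
  exists x, basic_set a x.
Proof.
move=> [_ _ /(_ a)[_ _ loc]] a0; apply: contrapT => /forallNP empty.
have [x Ux] : exists x, oset U x.
  apply: contrapT => /forallNP U0; apply: a0; exact: sect_empty.
have [n] : exists n, a ^+ n * 1 = 0 by apply: loc; exact: sect_empty.
by rewrite mulr1 => /(sect_expf_eq0 Ux).
Qed.

Lemma basic_neq0 U (a : sect U) x : basic_set a x -> a <> 0.
Proof.
move=> [Ux [b]] /[swap] -> /=; rewrite -(stalk_zeroE Ux) => b0.
have : (0 : stalk x) = 1 by rewrite -b0 mulr0.
by move/esym/eqP; rewrite (negbTE (stalk_oner_neq0 x)).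
Qed.

Lemma affine_fraction U V (x : X) (s : sect V) : affine U -> oset U x -> oset V x ->
  exists (f a : sect U) (n : nat) (hU : basic_open f `<=` U) (hV : basic_open f `<=` V),
    basic_set f x /\ res hU f ^+ n * res hV s = res hU a.
Proof.
move=> [_ basis loc] Ux Vx; have [f [fx fV]] := basis V x Vx Ux.
have [_ surj _] := loc f; have [a [n e]] := surj (res (fV : basic_open f `<=` V) s).
by exists f, a, n, (@basic_open_sub X U f), fV.
Qed.

(** Near any point, f^n s = a on some D(f) in an affine W. On a nonempty D(g) inside D(f) and V, a
    restricts to 0; hence a power of g kills a in the domain O(W), and a = 0. *)
Lemma res_eq0 U V (h : V `<=` U) y (s : sect U) : oset V y -> res h s = 0 -> s = 0.
Proof.
move=> Vy s0; apply: sect_local => x Ux; have [W [Wx affW]] := sch_affine x.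
have [f [a [n [hW [hU [fx e]]]]]] := affine_fraction s affW Wx Ux.
exists (basic_open f), hU; split=> //.
have fx' : oset (basic_open f) x by [].
have [z [fz Vz]] := opens_meet fx' Vy.
have Wz : oset W z by exact (hW z fz).
have fVz : oset (oI (basic_open f) V) z by [].
have [_ basis loc] := affW; have [g [gz gfV]] := basis _ _ fVz Wz.
have a0 : a = 0.
  have [_ _ /(_ a)[]] := loc g; last first.
    move=> n0 ga; have [|//] := sect_integral ga.
    by move/(sect_expf_eq0 Wz)/(basic_neq0 gz).
  have gf : basic_open g `<=` basic_open f by move=> u /gfV[].
  have gV : basic_open g `<=` V by move=> u /gfV[].
  rewrite -(rs_res_comp hW gf) -e rmorphM (rs_res_comp _ _ (subset_trans gV h)).
  by rewrite -(rs_res_comp h gV) s0 rmorph0 mulr0.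
move: e; rewrite a0 !rmorph0 => /sect_integral[|//].
move/(sect_expf_eq0 fx') => f0.
have := @basic_neq0 _ (res hW f) x; rewrite f0.
by case=> //; rewrite -f0; apply/basic_set_res.
Qed.

Lemma res_inj U V (h : V `<=` U) y : oset V y -> injective (res h).
Proof.
move=> Vy s t st; apply/eqP; rewrite -subr_eq0; apply/eqP.
by apply: (@res_eq0 _ _ h y) => //; rewrite rmorphB st subrr.
Qed.

Lemma germ_inj U x (hx : oset U x) : injective (germ hx).
Proof.
move=> s t /germ_eq[W [Wx [h [h' e]]]]; apply: (res_inj (h := h) Wx).
by rewrite e; exact: res_irr.
Qed.

(** The zero ideal of an affine chart is prime, and its point lies in every nonempty D(f). *)
Lemma ex_generic_pt : exists x, generic_pt x.
Proof.
have [x0 _] := int_nonempty X; have [U [Ux0 affU]] := sch_affine x0.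
have [spec basis _] := affU.
have [|x [[Ux xP] _]] := spec [set 0].
  split=> //; first by move=> a b -> ->; rewrite addr0.
  - by move=> a b ->; rewrite mulr0.
  - exact: sect_oner_neq0 Ux0.
  - by move=> a b /sect_integral.
exists x; apply/seteqP; split=> // y _ B; rewrite nbhsE => -[V [oV Vy] VB].
have [z [Uz Vz]] := @opens_meet U (Opens oV) x0 y Ux0 Vy.
have [f [fz fV]] := basis (Opens oV) z Vz Uz.
exists x; split=> //; apply/VB/fV; apply: contrapT => nfx.
have : [set f | ~ basic_set f x] f by [].
by rewrite -xP /= => f0; move: (basic_neq0 fz).
Qed.

Lemma generic_ptP x : generic_pt x <-> forall U y, oset U y -> oset U x.
Proof.
split=> [gen U y Uy|gen].
  have : closure [set x] y by rewrite gen.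
  by move=> /(_ U)[|z [/= -> //]]; apply: open_nbhs_nbhs; split=> //; exact: opens_open.
apply/seteqP; split=> // y _ B; rewrite nbhsE => -[V [oV Vy] VB].
by exists x; split=> //; apply: VB; exact: (gen (Opens oV) y).
Qed.

Lemma specializesP x z : closure [set z] x <-> forall U, oset U x -> oset U z.
Proof.
split=> [cl U Ux|gen].
  have [|w [/= -> //]] := cl U; apply: open_nbhs_nbhs; split=> //; exact: opens_open.
move=> B; rewrite nbhsE => -[V [oV Vx] VB].
by exists z; split=> //; apply: VB; exact: (gen (Opens oV)).
Qed.

End IntegralScheme.

Section Germ.
Variables (X : ringedSpace) (x : X) (U : opens X) (hx : oset U x).

Lemma germ_zmod_morphism : zmod_morphism (germ hx).
Proof.
move=> s t; rewrite -[LHS](stalk_addE hx); congr (_ + _).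
by rewrite -[LHS](stalk_oppE hx).
Qed.

Lemma germ_monoid_morphism : monoid_morphism (germ hx).
Proof. by split=> [|s t]; [rewrite -stalk_oneE|rewrite -stalk_mulE]. Qed.

HB.instance Definition _ := GRing.isZmodMorphism.Build (sect U) (stalk x) (germ hx)
  germ_zmod_morphism.
HB.instance Definition _ := GRing.isMonoidMorphism.Build (sect U) (stalk x) (germ hx)
  germ_monoid_morphism.

End Germ.

Section Basic.
Variable X : integralScheme.
Implicit Types (U V : opens X) (x : X).

Lemma basic_unit U x (hx : oset U x) (f : sect U) :
  basic_set f x <-> germ hx f \is a GRing.unit.
Proof. by rewrite (germ_inv_basic hx) stalk_unitE; split=> /asboolP. Qed.

Lemma basicM U x (f g : sect U) : basic_set (f * g) x <-> basic_set f x /\ basic_set g x.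
Proof.
split=> [fg|[[hx fx] gx]].
  have hx : oset U x by case: fg.
  by move: fg; rewrite !(basic_unit hx) rmorphM unitrM => /andP.
have {}fx : basic_set f x by exists hx.
by move: fx gx; rewrite !(basic_unit hx) rmorphM unitrM => -> ->.
Qed.

Lemma basic1 U x : oset U x -> basic_set (1 : sect U) x.
Proof. by move=> hx; rewrite (basic_unit hx) rmorph1 unitr1. Qed.

Lemma basicX U x (f : sect U) n : basic_set f x -> basic_set (f ^+ n) x.
Proof.
move=> fx; elim: n => [|n IHn]; last by rewrite exprS; apply/basicM.
by apply: basic1; case: fx.
Qed.

Lemma stalk_fraction U x (hx : oset U x) (g : stalk x) : affine U ->
  exists a f : sect U, basic_set f x /\ germ hx f * g = germ hx a.
Proof.
move=> affU; have [V [Vx [s ->]]] := germ_ex g.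
have [f [a [n [hU [hV [fx e]]]]]] := affine_fraction s affU hx Vx.
exists a, (f ^+ n); split; first exact: basicX.
have fx' : oset (basic_open f) x by [].
rewrite -(germ_res hU hx fx') -(germ_res hV Vx fx') -(germ_res hU hx fx' a) -e.
by rewrite -rmorphM -rmorphXn.
Qed.

End Basic.

(* The generic point is a parameter so that the field structure can be inferred. *)
Definition function_field (X : integralScheme) (xi : X) (gen : generic_pt xi) : Type :=
  stalk xi.

Section FunctionField.
Variables (X : integralScheme) (xi : X) (gen : generic_pt xi).
Implicit Types (U V : opens X) (x : X).

Local Notation FF := (function_field gen).

HB.instance Definition _ := GRing.IntegralDomain.on FF.

Lemma generic_in U x : oset U x -> oset U xi.
Proof. by move/generic_ptP: gen => gen'; exact: gen'. Qed.

Lemma function_field_axiom : GRing.field_axiom FF.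
Proof.
move=> g; have [U [Uxi affU]] := sch_affine xi => g0.
have [a [f [fxi e]]] := stalk_fraction Uxi (g : stalk xi) affU.
have a0 : a <> 0.
  move=> a0; move: e; rewrite a0 rmorph0 => /eqP.
  rewrite mulf_eq0 (negbTE g0) orbF => /eqP f0.
  by move: fxi; rewrite (basic_unit Uxi) f0 unitr0.
have [y ay] := affine_basic_nonempty affU a0.
have : basic_set a xi by exact: (@generic_in (basic_open a) y ay).
by rewrite (basic_unit Uxi) -e unitrM => /andP[].
Qed.

HB.instance Definition _ := GRing.UnitRing_isField.Build FF
  function_field_axiom.

Definition sect_ff U (h : oset U xi) (s : sect U) : FF := germ h s.

HB.instance Definition _ U (h : oset U xi) := GRing.isZmodMorphism.Build
  (sect U) FF (sect_ff h) (germ_zmod_morphism h).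
HB.instance Definition _ U (h : oset U xi) := GRing.isMonoidMorphism.Build
  (sect U) FF (sect_ff h) (germ_monoid_morphism h).

Definition to_ff x (g : stalk x) : FF :=
  @sect_ff (pg_dom (repr g)) (generic_in (pg_in (repr g))) (pg_sect (repr g)).

Lemma sect_ff_res U V (h : V `<=` U) (hU : oset U xi) (hV : oset V xi) (s : sect U) :
  sect_ff hV (res h s) = sect_ff hU s.
Proof. exact: germ_res. Qed.

Lemma sect_ff_inj U (h : oset U xi) : injective (sect_ff h).
Proof. exact: germ_inj. Qed.

Lemma to_ff_germ U x (hx : oset U x) (h : oset U xi) (s : sect U) :
  to_ff (germ hx s) = sect_ff h s.
Proof.
rewrite /to_ff; set r := repr _.
have : germ (pg_in r) (pg_sect r) = germ hx s.
  by rewrite -[RHS]reprK -/r /germ; case: (r).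
move=> /germ_eq[W [Wx [h1 [h2 e]]]].
rewrite -(sect_ff_res h1 _ (generic_in Wx)) e; exact: sect_ff_res.
Qed.

Lemma to_ff_zmod_morphism x : zmod_morphism (@to_ff x).
Proof.
move=> a b; have [U [hU [s [t [-> ->]]]]] := germ_ex2 a b.
by rewrite -rmorphB !(to_ff_germ _ (generic_in hU)) rmorphB.
Qed.

Lemma to_ff_monoid_morphism x : monoid_morphism (@to_ff x).
Proof.
split=> [|a b].
  by rewrite -(rmorph1 (@germ X x (oT X) I)) (to_ff_germ _ (I : oset (oT X) xi)) rmorph1.
have [U [hU [s [t [-> ->]]]]] := germ_ex2 a b.
by rewrite -rmorphM !(to_ff_germ _ (generic_in hU)) rmorphM.
Qed.

HB.instance Definition _ x := GRing.isZmodMorphism.Build (stalk x) FF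
  (@to_ff x) (@to_ff_zmod_morphism x).
HB.instance Definition _ x := GRing.isMonoidMorphism.Build (stalk x) FF
  (@to_ff x) (@to_ff_monoid_morphism x).

Lemma to_ff_inj x : injective (@to_ff x).
Proof.
move=> a b; have [U [hU [s [t [-> ->]]]]] := germ_ex2 a b.
by rewrite !(to_ff_germ _ (generic_in hU)) => /sect_ff_inj->.
Qed.

Lemma chart_fraction U x (h : oset U xi) phi : affine U -> oset U x ->
  range (@to_ff x) phi -> exists a f : sect U,
    basic_set f x /\ phi = sect_ff h a / sect_ff h f.
Proof.
move=> affU hx [g _ <-]; have [a [f [fx e]]] := stalk_fraction hx g affU.
exists a, f; split=> //; apply: (@mulfI _ (sect_ff h f)).
  by apply/eqP => f0; apply: (basic_neq0 fx); apply: (sect_ff_inj (h := h)); rewrite f0 rmorph0.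
rewrite -!(to_ff_germ hx h) -e rmorphM mulrCA mulfV ?mulr1 //.
rewrite -(rmorph0 (@to_ff x)) (inj_eq (@to_ff_inj x)); apply/eqP => f0.
by move: fx; rewrite (basic_unit hx) f0 unitr0.
Qed.

Lemma chart_regular U x (h : oset U xi) (a f : sect U) : basic_set f x ->
  range (@to_ff x) (sect_ff h a / sect_ff h f).
Proof.
move=> fx; have hx : oset U x by case: fx.
move: fx; rewrite (basic_unit hx) => uf.
exists (germ hx a / germ hx f) => //.
by rewrite rmorphM rmorphV //= !(to_ff_germ hx h).
Qed.

Lemma sect_ff_neq0 U (h : oset U xi) (f : sect U) x : basic_set f x -> sect_ff h f != 0.
Proof.
move=> fx; apply/eqP => f0; apply: (basic_neq0 fx).
by apply: (sect_ff_inj (h := h)); rewrite f0 rmorph0.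
Qed.

Lemma sect_ff_regular U x (h : oset U xi) (a : sect U) : oset U x ->
  range (@to_ff x) (sect_ff h a).
Proof. by move=> hx; exists (germ hx a); rewrite ?(to_ff_germ hx h). Qed.

Lemma sect_ff_fraction U (h : oset U xi) phi : affine U -> exists a b : sect U,
  sect_ff h b != 0 /\ phi = sect_ff h a / sect_ff h b.
Proof.
move=> affU; have [|a [f [fxi ->]]] := @chart_fraction U xi h phi affU h.
  have [V [hV [s ->]]] := germ_ex (phi : stalk xi).
  by exists (germ hV s); rewrite ?(to_ff_germ hV hV).
by exists a, f; split=> //; exact: sect_ff_neq0 fxi.
Qed.

Lemma to_ff_fraction x phi : exists a b : stalk x, b != 0 /\ phi = to_ff a / to_ff b.
Proof.
have [U [hx affU]] := sch_affine x; have h := generic_in hx.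
have [a [b [b0 ->]]] := sect_ff_fraction h phi affU.
exists (germ hx a), (germ hx b); rewrite !(to_ff_germ hx h); split=> //.
by apply: contraNneq b0 => b0; rewrite -(to_ff_germ hx h) b0 rmorph0.
Qed.

(** Local sections representing [phi] agree on overlaps, since sections over a nonempty open set
    embed into the function field. *)
Lemma glue_rational V (h : oset V xi) phi :
  (forall x, oset V x -> range (@to_ff x) phi) -> exists s, sect_ff h s = phi.
Proof.
move=> phiV.
have loc (x : {x | oset V x}) : exists W (s : sect W) (hW : oset W xi),
    [/\ W `<=` V, oset W (sval x) & sect_ff hW s = phi].
  case: x => x Vx /=; have [g _ <-] := phiV x Vx.
  have [W [Wx [s ->]]] := germ_ex g.
  have Wx' : oset (oI W V) x by [].
  exists (oI W V), (res (@oIl _ W V) s), (generic_in Wx'); split=> //.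
    exact: oIr.
  by rewrite (sect_ff_res _ (generic_in Wx)) (to_ff_germ Wx (generic_in Wx)).
pose I := {x : X | oset V x}; pose W (i : I) := projT1 (cid (loc i)).
have loc' (x : I) : exists (s : sect (W x)) (hW : oset (W x) xi),
    [/\ W x `<=` V, oset (W x) (sval x) & sect_ff hW s = phi].
  exact: (projT2 (cid (loc x))).
pose s (x : I) := projT1 (cid (loc' x)).
have sP (x : I) : exists hW : oset (W x) xi,
    [/\ W x `<=` V, oset (W x) (sval x) & sect_ff hW (s x) = phi].
  exact: (projT2 (cid (loc' x))).
have WV (x : I) : W x `<=` V by case: (sP x) => ? [].
have cov : V `<=` \bigcup_i W i.
  by move=> x Vx; exists (exist _ x Vx) => //; case: (sP (exist _ x Vx)) => ? [].
have [|t [tP _]] := rs_glue WV cov (s := s).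
  move=> i j W' hi hj; have [[y W'y]|W'0] := pselect (exists y, oset W' y); last first.
    by apply: sect_empty => y W'y; apply: W'0; exists y.
  apply: (sect_ff_inj (h := generic_in W'y)).
  have [hWi [_ _ ei]] := sP i; have [hWj [_ _ ej]] := sP j.
  by rewrite (sect_ff_res hi hWi) (sect_ff_res hj hWj) ei ej.
exists t; have [hW [_ _ <-]] := sP (exist _ xi h).
by rewrite -tP (sect_ff_res _ h).
Qed.

Lemma noetherian_stalk U x (h : oset U xi) : affine U -> oset U x ->
  noetherian (range (sect_ff h)) -> noetherian (range (@to_ff x)).
Proof.
move=> affU hx noethU; apply: (noetherian_fractions noethU).
- exact: subring_range.
- by move=> _ [a _ <-]; exact: sect_ff_regular.
move=> phi /(chart_fraction h affU hx)[a [f [fx ->]]].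
exists (sect_ff h a), (sect_ff h f); split=> //; first exact: sect_ff_neq0 fx.
by rewrite -div1r -(rmorph1 (sect_ff h)); exact: chart_regular.
Qed.

Lemma normal_integral x theta n (c : nat -> FF) : normal X ->
  (forall i, range (@to_ff x) (c i)) -> theta ^+ n = \sum_(i < n) c i * theta ^+ i ->
  range (@to_ff x) theta.
Proof.
move=> normX Rc e; have /choice[d dP] : forall i, exists d : stalk x, to_ff d = c i.
  by move=> i; have [d _ <-] := Rc i; exists d.
have [a [b [b0 thetaE]]] := to_ff_fraction x theta.
have fb0 : to_ff b != 0 by rewrite -(rmorph0 (@to_ff x)) (inj_eq (@to_ff_inj x)).
pose F := @FracField.tofrac (stalk x).
have Fb0 : F b != 0 by rewrite tofrac_eq0.
have eq_ab : a ^+ n = \sum_(i < n) d i * (a ^+ i * b ^+ (n - i)).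
  apply: (@to_ff_inj x); move: e; rewrite thetaE => /(fraction_root_homogeneous _ _ _ fb0).
  rewrite rmorphXn => ->; rewrite rmorph_sum; apply: eq_bigr => i _ /=.
  by rewrite !rmorphM !rmorphXn /= dP.
have [|g gE] := normX x (F a / F b).
  exists ('X^n - \poly_(i < n) d i).
    rewrite monicE lead_coefDl ?lead_coefXn // size_polyXn size_polyN ltnS.
    exact: size_poly.
  rewrite rmorphB /= map_polyXn /root hornerD hornerN hornerXn subr_eq0.
  have -> : map_poly F (\poly_(i < n) d i) = \poly_(i < n) F (d i).
    by apply/polyP => i; rewrite coef_map !coef_poly; case: ifP => // _; rewrite tofrac0.
  rewrite horner_poly; apply/eqP; apply/(fraction_root_homogeneous _ _ (F \o d) Fb0).
  rewrite -tofracXn eq_ab rmorph_sum; apply: eq_bigr => i _ /=.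
  by rewrite !tofracM !tofracXn.
exists g => //; rewrite thetaE; apply: (mulIf fb0); rewrite divfK // -rmorphM; congr to_ff.
apply/eqP; rewrite -tofrac_eq; apply/eqP.
by rewrite tofracM -gE divfK.
Qed.

End FunctionField.

(** * Hartogs lemma *)

Lemma mulr_exchange (L : comNzRingType) (a b c d theta : L) :
  a = b * theta -> c = d * theta -> a * d = c * b.
Proof. by move=> -> ->; ring. Qed.

Section Variety.
Variables (p : nat) (X : integralScheme) (varX : F_finite_variety p X).
Variables (xi : X) (gen : generic_pt xi).

Lemma variety_chart (x : X) : exists U : opens X,
  [/\ oset U x, affine U & forall h : oset U xi, noetherian (range (sect_ff gen h))].
Proof.
have [k [i [_ _ [n [U [cov ftU]]]]]] := varX.
have [j Ujx] := cov x; exists (U j); have [affU ft] := ftU j; split=> // h.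
have noeth := @noetherian_finite_type _ _ _ (res (sub_oT (U j)) \o i) (sect_ff gen h) ft.
exact noeth.
Qed.

Lemma function_field_pchar : p \in [pchar (function_field gen)].
Proof.
have [k [i [charp _ _]]] := varX.
exact: (rmorph_pchar (sect_ff gen (I : oset (oT X) xi) \o i) charp).
Qed.

Lemma function_field_F_finite : F_finite p (function_field gen).
Proof.
have [k [i [charp Fk [n [U [cov ftU]]]]]] := varX.
have [j h] := cov xi; have [affU ft] := ftU j.
have frac phi : exists a b, phi = sect_ff gen h a / sect_ff gen h b.
  by have [a [b [_ ->]]] := sect_ff_fraction h phi affU; exists a, b.
exact (@F_finite_fraction (function_field gen) p function_field_pchar _ _
  (res (sub_oT (U j)) \o i) (sect_ff gen h) Fk ft frac).
Qed.

End Variety.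

Section Hartogs.
Variables (X : integralScheme) (normX : normal X).
Variables (xi : X) (gen : generic_pt xi) (U : opens X) (h : oset U xi).
Hypotheses (affU : affine U) (noethU : noetherian (range (sect_ff gen h))).
Variables (V : opens X) (phi : function_field gen).
Hypothesis phi_reg : forall z, oset V z -> codim_one z -> range (@to_ff X xi gen z) phi.
Local Notation R := (range (sect_ff gen h)).
Local Notation gam := (sect_ff gen h).

Let subR : is_subring R. Proof. exact (subring_range (sect_ff gen h)). Qed.

(** z is the point of an associated prime of phi modulo R, namely the conductor of theta = c phi.
    The factor c is chosen so that g stays outside this prime, which keeps z in D(g) and hence in
    V. *)
Lemma conductor_point (x : X) : oset U x -> oset V x ->
  ~ range (@to_ff X xi gen x) phi ->
  exists (z : X) (theta : function_field gen), [/\ oset U z, oset V z,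
    ~ range (@to_ff X xi gen z) theta,
    range (@to_ff X xi gen z) phi -> range (@to_ff X xi gen z) theta &
    forall f : sect U, ~ basic_set f z <-> R (gam f * theta)].
Proof.
move=> Ux Vx nphi; have [spec basis _] := affU.
have [g [gx gV]] := basis V x Vx Ux.
have [||c [[c' _ <-] ngc prm]] := prime_conductor (phi := phi) (g := gam g) subR noethU.
- by exists g.
- move=> m [a _ e]; apply: nphi.
  have gm0 := sect_ff_neq0 gen h (basicX m gx).
  have -> : phi = gam a / gam (g ^+ m).
    by apply: (@mulfI _ (gam (g ^+ m))) => //; rewrite mulrCA divff // mulr1 e rmorphXn.
  by apply: chart_regular; exact: basicX.
pose theta := gam c' * phi.
pose P : set (sect U) := [set f | R (gam f * theta)].
have PE f : gam f * gam c' * phi = gam f * theta by rewrite mulrA.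
have [|z [[Uz zP] _]] := spec P.
  rewrite /P; split=> /=.
  - by rewrite rmorph0 mul0r; exact: (subring0 subR).
  - by move=> a b Pa Pb; rewrite rmorphD mulrDl; exact: (subringD subR).
  - by move=> a b Pb; rewrite rmorphM -mulrA; apply: (subringM subR) => //; exists a.
  - rewrite rmorph1 mul1r => R1; apply: ngc; rewrite PE.
    by apply: (subringM subR) => //; exists g.
  - move=> a b; rewrite rmorphM => Rab.
    have Ra : R (gam a) by exists a.
    have Rb : R (gam b) by exists b.
    have [|Pa|Pb] := prm (gam a) (gam b) Ra Rb; first by rewrite -mulrA.
      by left; rewrite -PE.
    by right; rewrite -PE.
have zE f : ~ basic_set f z <-> R (gam f * theta).
  by split=> [nf|Pf]; [have : P f by rewrite zP|have : P f by []; rewrite zP].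
exists z, theta; split=> //.
- by apply: gV; apply: contrapT => /zE; rewrite -PE.
- move=> /(chart_fraction h affU Uz)[a [f [fz e]]].
  have /zE : R (gam f * theta); last by [].
  by rewrite e mulrCA divff ?mulr1; [exists a|exact: sect_ff_neq0 fz].
- by apply: subringM; [exact (subring_range (@to_ff X xi gen z))|exact: sect_ff_regular].
Qed.

(** Let P be the prime of z, the conductor of theta. If theta P were inside P, theta would be
    integral and regular at z by normality. So Pi theta = u with Pi in P and u outside P, and Pi
    generates P at z. *)
Lemma conductor_codim_one (z : X) (theta : function_field gen) : oset U z ->
  ~ range (@to_ff X xi gen z) theta ->
  (forall f : sect U, ~ basic_set f z <-> R (gam f * theta)) -> codim_one z.
Proof.
move=> Uz ntheta zE; have [spec basis _] := affU.
have not_integral (b : sect U) (f : nat -> sect U) : gam b != 0 ->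
    ~ (forall k, gam (f k) = gam b * theta ^+ k).
  move=> b0 fE; have [|n [c [Rc e]]] := noetherian_integral (theta := theta) noethU b0.
    by move=> k; exists (f k).
  apply: ntheta; apply: (normal_integral normX _ e) => i; have [d _ <-] := Rc i.
  exact: sect_ff_regular.
(* A set of sections stable under theta and containing b != 0 contains all b theta^k, which makes
   theta integral. *)
have iterate (Q : set (sect U)) (b : sect U) : gam b != 0 -> Q b ->
    (forall f, Q f -> exists2 f', Q f' & gam f' = gam f * theta) -> False.
  move=> b0 Qb step.
  have /choice[next nextP] : forall f, exists f', Q f -> Q f' /\ gam f' = gam f * theta.
    move=> f; have [/step[f' Qf' e]|nQ] := pselect (Q f); first by exists f'.
    by exists 0.
  have Qn k : Q (iter k next b) by elim: k => //= k /nextP[].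
  apply: (not_integral b (fun k => iter k next b) b0); elim=> [|k IHk].
    by rewrite expr0 mulr1.
  by have [_ ->] := nextP _ (Qn k); rewrite IHk exprSr mulrA.
have [a [b [b0 thetaE]]] := sect_ff_fraction h theta affU.
have bz : ~ basic_set b z.
  by apply/zE; exists a => //; rewrite thetaE mulrCA divff // mulr1.
have [Pi [u [Piz uz uE]]] : exists Pi u : sect U,
    [/\ ~ basic_set Pi z, basic_set u z & gam u = gam Pi * theta].
  apply: contrapT => no; apply: (iterate [set f | ~ basic_set f z] b) => // f fz.
  have /zE[f' _ f'E] := fz; exists f' => //= f'z; apply: no.
  by exists f, f'.
(* For x in P this exhibits x as a multiple of Pi wherever u does not vanish. *)
have uP (x x' : sect U) : gam x' = gam x * theta -> u * x = x' * Pi.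
  by move=> x'E; apply: (@sect_ff_inj _ _ gen _ h); rewrite !rmorphM; exact: mulr_exchange uE x'E.
split.
  move=> genz; apply: bz.
  have [|y fy] := affine_basic_nonempty affU (a := b).
    by move=> b0'; rewrite b0' rmorph0 eqxx in b0.
  exact: (@generic_in _ _ genz (basic_open b) y fy).
move=> w /specializesP zw; have Uw : oset U w by exact: zw.
have basic_zw (f : sect U) : basic_set f z -> basic_set f w.
  by move=> fz; exact: (zw (basic_open f) fz).
(* Let Q be the prime of w, contained in P. If Pi is in Q, then u f = r Pi gives P = Q; otherwise
   the same identity makes Q stable under theta, so Q = 0 and w is generic. *)
have [Piw|Piw] := pselect (basic_set Pi w); [right|left]; last first.
  have basic_wz (f : sect U) : basic_set f w <-> basic_set f z.
    split=> [fw|]; last exact: basic_zw.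
    apply: contrapT => /zE[r _ rE]; apply: Piw.
    have : basic_set (u * f) w by apply/basicM; split=> //; exact: basic_zw.
    by rewrite (uP f r) // => /basicM[].
  have primeP : prime_ideal [set f : sect U | ~ basic_set f z].
    split=> /=.
    - by move/basic_neq0.
    - move=> a' b' /zE Pa /zE Pb; apply/zE; rewrite rmorphD mulrDl; exact: (subringD subR).
    - by move=> a' b' nb /basicM[].
    - by move=> n1; apply: n1; exact: basic1.
    - move=> a' b' nab; apply: contrapT => /not_orP[/contrapT a'z /contrapT b'z].
      by apply: nab; apply/basicM.
  have [z' [_ uniq_z]] := spec _ primeP.
  rewrite -(uniq_z z) // (uniq_z w) //; split=> //.
  by apply/seteqP; split=> f /=; rewrite basic_wz.
have all_basic (f : sect U) : f <> 0 -> basic_set f w.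
  move=> f0; apply: contrapT => nfw.
  apply: (iterate [set f | ~ basic_set f w] f) => //.
    by apply/eqP => e; apply: f0; apply: (@sect_ff_inj _ _ gen _ h); rewrite e rmorph0.
  move=> f' nf'; have [r _ rE] : R (gam f' * theta).
    by apply/zE => /basic_zw.
  exists r => //= rw; apply: nf'.
  have : basic_set (r * Pi) w by apply/basicM.
  by rewrite -(uP f' r) // => /basicM[].
apply/generic_ptP => W y Wy; have [v [Uv Wv]] := opens_meet Uz Wy.
have [f [fv fW]] := basis W v Wv Uv.
by apply: fW; apply: all_basic; exact: basic_neq0 fv.
Qed.

Theorem hartogs (x : X) : oset U x -> oset V x -> range (@to_ff X xi gen x) phi.
Proof.
move=> Ux Vx; apply: contrapT => nphi.
have [z [theta [Uz Vz ntheta reg zE]]] := conductor_point Ux Vx nphi.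
by apply/ntheta/reg/phi_reg => //; exact: conductor_codim_one ntheta zE.
Qed.

End Hartogs.

(** * Morphisms *)

Section StalkMap.
Variables (Y X : ringedSpace) (f : ringedSpaceMor Y X) (y : Y).

Lemma stalk_mapE (U : opens X) (hU : oset U (f y)) (s : sect U) :
  stalk_map f y (germ hU s) = @germ Y y (opre (mor_cont f) U) hU (pull f U s).
Proof.
rewrite /stalk_map; set r := repr _.
have : germ (pg_in r) (pg_sect r) = germ hU s.
  by rewrite -[RHS]reprK -/r /germ; case: (r).
move=> /germ_eq[W [Wx [h1 [h2 e]]]]; apply: germP => /=.
have h1' : opre (mor_cont f) W `<=` opre (mor_cont f) (pg_dom r) by move=> z; exact: h1.
have h2' : opre (mor_cont f) W `<=` opre (mor_cont f) U by move=> z; exact: h2.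
exists (opre (mor_cont f) W); split=> //; exists h1', h2'.
by rewrite -(pull_res f h1) -(pull_res f h2) e.
Qed.

Lemma stalk_map_zmod_morphism : zmod_morphism (stalk_map f y).
Proof.
move=> a b; have [U [hU [s [t [-> ->]]]]] := germ_ex2 a b.
by rewrite -rmorphB !stalk_mapE !rmorphB.
Qed.

Lemma stalk_map_monoid_morphism : monoid_morphism (stalk_map f y).
Proof.
split=> [|a b].
  rewrite -(rmorph1 (@germ X (f y) (oT X) I)) stalk_mapE rmorph1.
  exact: (rmorph1 (@germ Y y (opre (mor_cont f) (oT X)) I)).
have [U [hU [s [t [-> ->]]]]] := germ_ex2 a b.
by rewrite -rmorphM !stalk_mapE !rmorphM.
Qed.

HB.instance Definition _ := GRing.isZmodMorphism.Build (stalk (f y)) (stalk y)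
  (stalk_map f y) stalk_map_zmod_morphism.
HB.instance Definition _ := GRing.isMonoidMorphism.Build (stalk (f y)) (stalk y)
  (stalk_map f y) stalk_map_monoid_morphism.

End StalkMap.

Section FrobHom.
Variables (p e : nat) (X : ringedSpace) (psi : frobHom p e X) (x : X).

Lemma stalk_frobE (U : opens X) (hU : oset U x) (s : sect U) :
  stalk_frob psi (germ hU s) = germ hU (psi U s).
Proof.
rewrite /stalk_frob; set r := repr _.
have : germ (pg_in r) (pg_sect r) = germ hU s.
  by rewrite -[RHS]reprK -/r /germ; case: (r).
move=> /germ_eq[W [Wx [h1 [h2 eW]]]]; apply: germP => /=.
by exists W; split=> //; exists h1, h2; rewrite -!frob_res eW.
Qed.

Lemma stalk_frob_linear : frob_linear (p ^ e) (@stalk_frob p e X psi x).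
Proof.
split=> a b; have [U [hU [s [t [-> ->]]]]] := germ_ex2 a b.
  by rewrite -rmorphD !stalk_frobE (frob_linearD (frob_appP psi U)) rmorphD.
by rewrite -rmorphXn -rmorphM !stalk_frobE (frob_linearZ (frob_appP psi U)) rmorphM.
Qed.

End FrobHom.

Section Residue.
Variables (X : integralScheme) (x : X).
Local Notation m := (max_ideal (x := x) : idealr (stalk x)).

Lemma residue_zmod_morphism : zmod_morphism (@residue X x).
Proof. exact: (rmorphB \pi_{ideal_quot m}%qT). Qed.

Lemma residue_monoid_morphism : monoid_morphism (@residue X x).
Proof. by split; [exact: (rmorph1 \pi_{ideal_quot m}%qT)|exact: residueM]. Qed.

HB.instance Definition _ := GRing.isZmodMorphism.Build (stalk x) (residue_field x)
  (@residue X x) residue_zmod_morphism.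
HB.instance Definition _ := GRing.isMonoidMorphism.Build (stalk x) (residue_field x)
  (@residue X x) residue_monoid_morphism.

End Residue.

Section ResidueMap.
Variables (Y X : integralScheme) (f : schemeMor Y X) (y : Y).

Lemma stalk_map_unit (a : stalk (f y)) :
  (stalk_map f y a \is a GRing.unit) = (a \is a GRing.unit).
Proof.
apply/idP/idP => [|ua]; last exact: rmorph_unit.
by rewrite !stalk_unitE => /asboolP/mor_local i; apply/asboolP.
Qed.

Lemma residue_mapE (a : stalk (f y)) :
  residue_map f y (residue a) = residue (stalk_map f y a).
Proof.
apply/eqP; rewrite -subr_eq0 -!rmorphB residue_eq0 stalk_map_unit -residue_eq0.
by rewrite rmorphB /= residueK subrr.
Qed.

Lemma residue_map_zmod_morphism : zmod_morphism (residue_map f y).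
Proof.
move=> a b; rewrite -[a]residueK -[b]residueK -rmorphB !residue_mapE.
by rewrite !rmorphB.
Qed.

Lemma residue_map_monoid_morphism : monoid_morphism (residue_map f y).
Proof.
split=> [|a b]; first by rewrite -(rmorph1 (@residue X (f y))) residue_mapE !rmorph1.
by rewrite -[a]residueK -[b]residueK -rmorphM !residue_mapE !rmorphM.
Qed.

HB.instance Definition _ := GRing.isZmodMorphism.Build (residue_field (f y))
  (residue_field y) (residue_map f y) residue_map_zmod_morphism.
HB.instance Definition _ := GRing.isMonoidMorphism.Build (residue_field (f y))
  (residue_field y) (residue_map f y) residue_map_monoid_morphism.

Lemma residue_frob_span (p e : nat) (u : stalk y) :
  p \in [pchar (stalk (f y))] -> separable_ext (residue_map f y) ->
  exists s : seq (stalk (f y) * stalk y),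
    u - \sum_(v <- s) stalk_map f y v.1 * v.2 ^+ (p ^ e) \isn't a GRing.unit.
Proof.
move=> charp sep; have charp' := rmorph_pchar (@residue X (f y)) charp.
have [s sE] := @separable_frob_span _ _ (residue_map f y) p charp' e (residue u) sep.
exists [seq (repr v.1, repr v.2) | v <- s]; rewrite -residue_eq0 rmorphB rmorph_sum /=.
rewrite sE big_map /= subr_eq0; apply/eqP; apply: eq_bigr => v _.
by rewrite rmorphM rmorphXn /= -residue_mapE !residueK.
Qed.

End ResidueMap.

Section Dominant.
Variables (Y X : integralScheme) (f : schemeMor Y X).
Hypotheses (fin_f : finite_mor f) (surj_f : surjective_mor f) (sep_f : separable_mor f).
Variables (eta : Y) (genY : generic_pt eta).

Lemma generic_image : generic_pt (f eta).
Proof.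
apply/generic_ptP => U x Ux; have [y yx] := surj_f x.
have Uy : oset (opre (mor_cont f) U) y by rewrite /= /preimage /= yx.
exact: (generic_in genY Uy).
Qed.

Local Notation genX := generic_image.
Local Notation K := (function_field genX).
Local Notation L := (function_field genY).

Definition ff_map (a : K) : L := stalk_map f eta a.

HB.instance Definition _ := GRing.isZmodMorphism.Build K L ff_map
  (stalk_map_zmod_morphism (f := f) (y := eta)).
HB.instance Definition _ := GRing.isMonoidMorphism.Build K L ff_map
  (stalk_map_monoid_morphism f eta).

Lemma ff_map_sect (U : opens X) (h : oset U (f eta))
  (h' : oset (opre (mor_cont f) U) eta) (s : sect U) :
  ff_map (sect_ff genX h s) = sect_ff genY h' (pull f U s).
Proof.
by rewrite /ff_map /sect_ff stalk_mapE (Prop_irrelevance (h : oset (opre (mor_cont f) U) eta) h').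
Qed.

Lemma ff_map_to_ff (y : Y) (a : stalk (f y)) :
  ff_map (to_ff genX a) = to_ff genY (stalk_map f y a).
Proof.
have [U [hU [s ->]]] := germ_ex a; rewrite stalk_mapE.
have h : oset U (f eta) := generic_in genX hU.
have h' : oset (opre (mor_cont f) U) eta := h.
by rewrite (to_ff_germ genX hU h) (to_ff_germ genY _ h') (ff_map_sect h h').
Qed.

Lemma ff_map_separable : separable_ext ff_map.
Proof. exact: sep_f. Qed.

Lemma ff_map_finite : finite_map ff_map.
Proof.
have [U [h affU]] := sch_affine (f eta); have [affV finV] := fin_f affU.
have h' : oset (opre (mor_cont f) U) eta := h.
apply: (finite_map_fraction (f := pull f U) (a := sect_ff genX h)
  (b := sect_ff genY h')) finV ff_map_separable _.
  by move=> s; rewrite /= (ff_map_sect h h').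
by move=> x; have [a [b [b0 ->]]] := sect_ff_fraction h' x affV; exists a, b.
Qed.

End Dominant.

Section FrobFunctionField.
Variables (p e : nat) (X : integralScheme) (varX : F_finite_variety p X).
Variables (xi : X) (gen : generic_pt xi) (psi : frobHom p e X).
Local Notation K := (function_field gen).

Definition ff_frob (a : K) : K := stalk_frob psi a.

Lemma ff_frob_linear : frob_linear (p ^ e) ff_frob.
Proof. exact: stalk_frob_linear. Qed.

Lemma ff_frob_sect (U : opens X) (h : oset U xi) (s : sect U) :
  ff_frob (sect_ff gen h s) = sect_ff gen h (psi U s).
Proof. exact: stalk_frobE. Qed.

Lemma ff_frob_to_ff (x : X) (a : stalk x) :
  ff_frob (to_ff gen a) = to_ff gen (stalk_frob psi a).
Proof.
have [U [hU [s ->]]] := germ_ex a; rewrite stalk_frobE.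
have h := generic_in gen hU.
by rewrite !(to_ff_germ gen hU h) ff_frob_sect.
Qed.

Lemma ff_frob_neq0 : frob_nonzero psi -> exists a, ff_frob a != 0.
Proof.
move=> [U [s psi_s]]; have [x Ux] : exists x, oset U x.
  apply: contrapT => /forallNP U0; apply: psi_s; exact: sect_empty.
have h := generic_in gen Ux; exists (sect_ff gen h s); rewrite ff_frob_sect.
apply/eqP => e0; apply: psi_s; apply: (@sect_ff_inj _ _ gen _ h).
by rewrite e0 rmorph0.
Qed.

Lemma stalk_noetherian (x : X) : noetherian (range (@to_ff X xi gen x)).
Proof.
have [U [hx affU noethU]] := variety_chart varX gen x.
have h := generic_in gen hx; exact: noetherian_stalk affU hx (noethU h).
Qed.

Lemma stalk_dvr (x : X) (t : stalk x) : uniformizer t ->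
  is_dvr (range (@to_ff X xi gen x)) (to_ff gen t).
Proof.
exact: (uniformizer_dvr (@to_ff_inj X xi gen x) (@to_ff_fraction X xi gen x)
  (@stalk_noetherian x)).
Qed.

Lemma D_psi_order (x : X) (t : stalk x) (z : K) : frob_nonzero psi -> uniformizer t ->
  (forall b, range (@to_ff X xi gen x) b -> range (@to_ff X xi gen x) (ff_frob (z * b)))
  <-> range (@to_ff X xi gen x) (z * to_ff gen t ^+ D_psi psi x).
Proof.
move=> psi0 unif_t; have charp := function_field_pchar varX gen.
have q_gt0 : (0 < p ^ e)%N by rewrite expn_gt0 (prime_gt0 (pcharf_prime charp)).
have fin_q := F_finite_iter charp e (function_field_F_finite varX gen).
exact (frob_order_xget (@to_ff_inj X xi gen x) (@to_ff_fraction X xi gen x) q_gt0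
  (@stalk_noetherian x) fin_q unif_t ff_frob_linear
  (@ff_frob_to_ff x) (ff_frob_neq0 psi0) z).
Qed.

End FrobFunctionField.

(** * The divisor of an extension *)

Section TamePoint.
Variables (p : nat) (X Y : integralScheme).
Hypotheses (varX : F_finite_variety p X) (varY : F_finite_variety p Y).
Variable f : schemeMor Y X.
Hypotheses (fin_f : finite_mor f) (surj_f : surjective_mor f) (sep_f : separable_mor f).
Variables (e : nat) (psi : frobHom p e X).
Hypothesis psi_neq0 : frob_nonzero psi.
Variables (eta : Y) (genY : generic_pt eta).
Local Notation genX := (generic_image surj_f genY).
Local Notation K := (function_field genX).
Local Notation L := (function_field genY).
Local Notation iota := (@ff_map Y X f surj_f eta genY).
Local Notation q := (p ^ e)%N.
Local Notation B y := (range (@to_ff Y eta genY y)).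

(** Both [ram_index] and [ord] default to 0, which p divides; an index prime to p therefore provides
    uniformizers on both sides. *)
Lemma tame_uniformizers (y : Y) : tame_at p f y ->
  exists (t : stalk (f y)) (T u : stalk y), [/\ uniformizer t, uniformizer T,
    u \is a GRing.unit & stalk_map f y t = u * T ^+ ram_index (stalk_map f y)].
Proof.
move=> [_ _ ram]; have ram0 : ram_index (stalk_map f y) != 0%N.
  by apply: contraNneq ram => ->; rewrite dvdn0.
move: ram0; rewrite /ram_index; case: xgetP => [n _ [t unif_t ->]|]; last by rewrite eqxx.
rewrite {1}/ord; case: xgetP => [m _ [T [u [unif_T uu e1]]]|]; last by rewrite eqxx.
move=> _; exists t; have ft0 : stalk_map f y t != 0.
  rewrite e1 mulf_neq0 //; first by apply: contraTneq uu => ->; rewrite unitr0.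
  by rewrite expf_neq0 //; case: unif_T.
have [v [vu e2]] := ordP (@to_ff_inj Y eta genY y)
  (@stalk_noetherian p Y varY eta genY y) unif_T ft0.
by exists T, v.
Qed.

Lemma frob_bounded_at (y : Y) (psi' : L -> L) : frob_linear q psi' ->
  (forall a, psi' (iota a) = iota (ff_frob psi a)) ->
  exists2 g, g != 0 & forall b, B y b -> B y (g * psi' b).
Proof.
move=> lin' psi'E; have [U [Ux affU]] := sch_affine (f y).
have [affV finV] := fin_f affU; have h := generic_in genX Ux.
have h' : oset (opre (mor_cont f) U) eta := h.
have Vy : oset (opre (mor_cont f) U) y := Ux.
have charp := function_field_pchar varX genX.
have fE s : sect_ff genY h' (pull f U s) = iota (sect_ff genX h s).
  by rewrite (ff_map_sect surj_f genY h h').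
have frac_a (x : K) : exists a b, sect_ff genX h b != 0 /\
    x = sect_ff genX h a / sect_ff genX h b by exact: sect_ff_fraction.
have frac_B (x : L) : exists a b, [/\ B y a, B y b, b != 0 & x = a / b].
  have [a [b [b0 ->]]] := @to_ff_fraction Y eta genY y x.
  exists (to_ff genY a), (to_ff genY b); split=> //.
  by rewrite -(rmorph0 (@to_ff Y eta genY y)) (inj_eq (@to_ff_inj Y eta genY y)).
have loc_B (x : L) : B y x -> exists a b, [/\ B y (sect_ff genY h' b)^-1,
    sect_ff genY h' b != 0 & x = sect_ff genY h' a / sect_ff genY h' b].
  move=> /(chart_fraction h' affV Vy)[a [b [by0 ->]]]; exists a, b; split=> //.
    by rewrite -div1r -(rmorph1 (sect_ff genY h')); exact: chart_regular.
  exact: sect_ff_neq0 by0.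
exact (frob_bounded_denominators (f := pull f U) (a := sect_ff genX h)
  (b := sect_ff genY h') (h := iota) (psiA := psi U) (psi := ff_frob psi)
  charp (@ff_map_separable _ _ _ surj_f sep_f eta genY) fE finV frac_a
  (subring_range (@to_ff Y eta genY y)) (fun c => sect_ff_regular genY h' c Vy)
  frac_B loc_B lin' (ff_frob_sect genX psi h) psi'E).
Qed.

(** Any extension [psi'] is allowed, so the criterion serves both for the map induced by a given
    [psibar] and for the one constructed from [psi]. *)
Lemma tame_order (y : Y) (psi' : L -> L) : tame_at p f y -> frob_linear q psi' ->
  (forall a, psi' (iota a) = iota (ff_frob psi a)) ->
  exists T : L, is_dvr (B y) T /\ (exists2 T' : stalk y, uniformizer T' & T = to_ff genY T') /\
    forall z, (forall b, B y b -> B y (psi' (z * b))) <->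
      B y (z * T ^ ((ram_index (stalk_map f y) * D_psi psi (f y))%N%:Z
                    - ((ram_index (stalk_map f y)).-1 * q.-1)%N%:Z)).
Proof.
move=> tame_y lin' psi'E; have [t [T' [u [unif_t unif_T uu tE]]]] := tame_uniformizers tame_y.
set n := ram_index _ in tE *; set d := D_psi psi (f y).
have charp := function_field_pchar varX genX; have p_pr := pcharf_prime charp.
pose T := to_ff genY T'; pose v := to_ff genY u.
have dvrB : is_dvr (B y) T := stalk_dvr varY genY unif_T.
have dvrA := stalk_dvr varX genX unif_t.
have [_ sep_res ndiv] := tame_y; rewrite -/n in ndiv.
have n_gt0 : (0 < n)%N by rewrite lt0n; apply: contraNneq ndiv => ->; rewrite dvdn0.
have q_gt0 : (0 < q)%N by rewrite expn_gt0 prime_gt0.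
have co_nq : coprime n q by apply: coprimeXr; rewrite coprime_sym prime_coprime.
have AB a : range (@to_ff X (f eta) genX (f y)) a -> B y (iota a).
  by move=> [b _ <-]; exists (stalk_map f y b); rewrite ?ff_map_to_ff.
have Bv : B y v by exists u.
have Bv1 : B y v^-1 by exists u^-1 => //; rewrite rmorphV.
have v0 : v != 0.
  rewrite /v -(rmorph0 (@to_ff Y eta genY y)) (inj_eq (@to_ff_inj Y eta genY y)).
  by apply: contraTneq uu => ->; rewrite unitr0.
have ht : iota (to_ff genX t) = v * T ^+ n.
  by rewrite ff_map_to_ff tE rmorphM rmorphXn.
have charp_st : p \in [pchar (stalk (f y))].
  rewrite inE p_pr /=; apply/eqP; apply: (@to_ff_inj _ _ genX).
  by rewrite rmorph_nat rmorph0 pcharf0.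
have res_span w : B y w -> exists s : seq (K * L),
    (forall x, x \in s -> range (@to_ff X (f eta) genX (f y)) x.1 /\ B y x.2) /\
    B y ((w - \sum_(x <- s) iota x.1 * x.2 ^+ q) / T).
  move=> [b _ <-]; have [s sP] := residue_frob_span e b charp_st sep_res.
  exists [seq (to_ff genX v.1, to_ff genY v.2) | v <- s]; split.
    by move=> _ /mapP[c _ ->]; split; [exists c.1|exists c.2].
  have [T0 TP] := unif_T; have [c cE] := (TP _).1 sP; exists c => //.
  have T0' : T != 0 by case: dvrB.
  apply: (mulIf T0'); rewrite divfK // -rmorphM mulrC -cE rmorphB rmorph_sum big_map.
  congr (_ - _); apply: eq_bigr => x _.
  by rewrite rmorphM rmorphXn /= ff_map_to_ff.
have psi_order (z : K) := D_psi_order varX z psi_neq0 unif_t.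
have zE z : z * T ^ ((n * d)%N%:Z - (n.-1 * q.-1)%N%:Z) =
    v^-1 ^+ d * (z * iota (to_ff genX t) ^+ d / T ^+ (n.-1 * q.-1)).
  have T0 : T != 0 by case: dvrB.
  by rewrite ht exprMn -exprM; exact: exprz_shift.
exists T; split=> //; split; first by exists T'.
move=> z; rewrite zE (dvr_unitM dvrB); last 3 first.
- by rewrite expf_neq0 // invr_eq0.
- exact (subringX (dvr_subring dvrB) d Bv1).
- by rewrite exprVn invrK; exact (subringX (dvr_subring dvrB) d Bv).
split.
  exact (fun zB => tame_order_lower dvrA dvrB AB Bv ht n_gt0 q_gt0 co_nq
    (ff_frob_linear genX psi) lin' psi'E psi_order zB).
have bnd := frob_bounded_at y lin' psi'E.
exact (fun Bz => tame_order_upper dvrA dvrB AB Bv Bv1 ht n_gt0 q_gt0 co_nq res_span lin'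
  psi'E psi_order bnd Bz).
Qed.

End TamePoint.

(** * From orders at points of codimension one to divisors *)

Lemma ram_divisor_le (n d c : nat) : (0 < n)%N -> (0 < c)%N ->
  ((n%:R - 1 : rat) <= n%:R * (d%:R / c%:R)) = (n.-1 * c <= n * d)%N.
Proof.
move=> n0 c0; rewrite mulrA ler_pdivlMr ?ltr0n // -[n in n%:R - 1](prednK n0).
by rewrite -natr1 addrK -!natrM ler_nat.
Qed.

Lemma ram_divisor_eq (n d c k : nat) : (0 < n)%N -> (0 < c)%N ->
  (k + n.-1 * c = n * d)%N ->
  (k%:R / c%:R : rat) = n%:R * (d%:R / c%:R) - (n%:R - 1).
Proof.
move=> n0 c0 e; have c1 : (c%:R : rat) != 0 by rewrite pnatr_eq0 -lt0n.
apply: (mulIf c1); rewrite mulrBl divfK // mulrA divfK // -natrM -e.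
by rewrite natrD -[n in n%:R - 1](prednK n0) -natr1 natrM; ring.
Qed.

Section Extension.
Variables (p : nat) (X Y : integralScheme).
Hypotheses (varX : F_finite_variety p X) (varY : F_finite_variety p Y).
Hypothesis normY : normal Y.
Variable f : schemeMor Y X.
Hypotheses (fin_f : finite_mor f) (surj_f : surjective_mor f) (sep_f : separable_mor f).
Hypothesis tame_f : tame_in_codim_one p f.
Variables (e : nat) (psi : frobHom p e X).
Hypothesis psi_neq0 : frob_nonzero psi.
Variables (eta : Y) (genY : generic_pt eta).
Local Notation genX := (generic_image surj_f genY).
Local Notation K := (function_field genX).
Local Notation L := (function_field genY).
Local Notation iota := (@ff_map Y X f surj_f eta genY).
Local Notation q := (p ^ e)%N.
Local Notation B y := (range (@to_ff Y eta genY y)).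

Lemma ram_index_gt0 (y : Y) : codim_one y -> (0 < ram_index (stalk_map f y))%N.
Proof.
move=> /tame_f[_ _ ndiv]; rewrite lt0n.
by apply: contraNneq ndiv => ->; rewrite dvdn0.
Qed.

Lemma D_psi_extension (psibar : frobHom p e Y) (y : Y) : extends f psibar psi ->
  codim_one y ->
  (D_psi psibar y + (ram_index (stalk_map f y)).-1 * q.-1 =
   ram_index (stalk_map f y) * D_psi psi (f y))%N.
Proof.
move=> ext codim_y.
have psi'E (a : K) : ff_frob psibar (iota a) = iota (ff_frob psi a).
  have [U [h [s ->]]] := germ_ex (a : stalk (f eta)).
  have h' : oset (opre (mor_cont f) U) eta := h.
  rewrite -[germ h s]/(sect_ff genX h s) ff_frob_sect !(ff_map_sect surj_f genY h h').
  by rewrite ff_frob_sect ext.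
have psibar_neq0 : frob_nonzero psibar.
  have [a a0] := ff_frob_neq0 genX psi_neq0.
  have : ff_frob psibar (iota a) != 0 by rewrite psi'E fmorph_eq0.
  have [U [h [s ->]]] := germ_ex (iota a : stalk eta).
  rewrite -[germ h s]/(sect_ff genY h s) ff_frob_sect => nz.
  by exists U, s => s0; rewrite s0 rmorph0 eqxx in nz.
have [T [dvrB [[T' unif_T TE] TP]]] := tame_order varX varY fin_f sep_f psi_neq0
  (tame_f codim_y) (ff_frob_linear genY psibar) psi'E.
have DP z := D_psi_order varY (gen := genY) z psibar_neq0 unif_T.
rewrite -TE in DP; have T0 : T != 0 by case: dvrB.
set D := D_psi psibar y in DP *; set m := _ - _ in TP.
(* T^-D B and T^-m B are the same module; testing z = T^-m and z = T^-D gives D = m. *)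
have eqD z : B y (z * T ^+ D) <-> B y (z * T ^ m) by rewrite -DP TP.
have B1 : B y 1 by exact: (subring1 (dvr_subring dvrB)).
have le1 : m <= D%:Z.
  have : B y (T ^ (- m) * T ^+ D) by apply/eqD; rewrite -expfzDr // addNr.
  by rewrite -[T ^+ D]/(T ^ D%:Z) -expfzDr // (dvrXz dvrB) addrC subr_ge0.
have le2 : D%:Z <= m.
  have : B y (T ^ (- D%:Z) * T ^ m).
    by apply/eqD; rewrite -[T ^+ D]/(T ^ D%:Z) -expfzDr // addNr.
  by rewrite -expfzDr // (dvrXz dvrB) addrC subr_ge0.
by move: le1 le2; rewrite /m; lia.
Qed.

(** A section is determined by its image in L. The Hartogs lemma makes [psi'] of a section regular
    at every point of its domain, and gluing turns it back into a section. *)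
Lemma frobHom_of_ff (psi' : L -> L) : frob_linear q psi' ->
  (forall y, codim_one y -> forall b, B y b -> B y (psi' b)) ->
  exists psibar : frobHom p e Y, forall (V : opens Y) (h : oset V eta) (s : sect V),
    sect_ff genY h (psibar V s) = psi' (sect_ff genY h s).
Proof.
move=> lin' psi'B.
have exF (V : opens Y) (s : sect V) : exists t : sect V,
    forall h : oset V eta, sect_ff genY h t = psi' (sect_ff genY h s).
  (* An open set without the generic point is empty, so any value serves there. *)
  have [h|nh] := pselect (oset V eta); last by exists s => h.
  have [|t tE] := glue_rational h (phi := psi' (sect_ff genY h s)); last first.
    by exists t => h'; rewrite (Prop_irrelevance h' h).
  move=> x Vx; have [U [Ux affU noethU]] := variety_chart varY genY x.
  have hU := generic_in genY Ux.
  apply: (hartogs normY affU (noethU hU) (V := V)) => // z Vz codim_z.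
  by apply: psi'B => //; exact: sect_ff_regular.
have [F FE] : exists F : forall V : opens Y, sect V -> sect V,
    forall V s (h : oset V eta), sect_ff genY h (F V s) = psi' (sect_ff genY h s).
  exists (fun V s => projT1 (cid (exF V s))) => V s; exact: (projT2 (cid (exF V s))).
have by_generic (V : opens Y) (s t : sect V) :
    (forall h : oset V eta, sect_ff genY h s = sect_ff genY h t) -> s = t.
  move=> st; have [h|nh] := pselect (oset V eta).
    by apply: (@sect_ff_inj _ _ genY _ h); exact: st.
  by apply: sect_empty => x Vx; apply: nh; exact (generic_in genY Vx).
have linF V : frob_linear q (F V).
  split=> s t; apply: by_generic => h; rewrite ?rmorphD ?rmorphM /= !FE.
    by rewrite rmorphD (frob_linearD lin').
  by rewrite rmorphM rmorphXn (frob_linearZ lin').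
have resF (U V : opens Y) (hVU : V `<=` U) (s : sect U) : F V (res hVU s) = res hVU (F U s).
  apply: by_generic => h; have hU := hVU _ h.
  by rewrite FE !(sect_ff_res genY hVU hU) FE.
by exists (@FrobHom p e Y F linF resF) => V h s; exact: FE.
Qed.

Lemma ex_extension :
  (forall y, codim_one y ->
    ((ram_index (stalk_map f y)).-1 * q.-1 <=
     ram_index (stalk_map f y) * D_psi psi (f y))%N) ->
  exists psibar : frobHom p e Y, extends f psibar psi.
Proof.
move=> le_ram; have charp := function_field_pchar varX genX.
have [psi' [lin' psi'E]] := frob_linear_extend charp (ff_map_finite fin_f surj_f sep_f genY)
  (ff_map_separable surj_f sep_f (genY := genY)) (ff_frob_linear genX psi).
have [|psibar barE] := frobHom_of_ff lin'.
  move=> y codim_y b Bb.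
  have [T [dvrB [_ TP]]] := tame_order varX varY fin_f sep_f psi_neq0 (tame_f codim_y)
    lin' psi'E.
  (* Stability of [B y] is the criterion at z = 1, where it asks for a nonnegative exponent of T. *)
  rewrite -[b]mul1r; apply: (TP 1).2 b Bb; rewrite mul1r; apply/(dvrXz dvrB).
  by have := le_ram y codim_y; lia.
exists psibar => U s; have [h'|nh] := pselect (oset (opre (mor_cont f) U) eta); last first.
  by apply: sect_empty => x Vx; apply: nh; exact (generic_in genY Vx).
have h : oset U (f eta) := h'.
apply: (@sect_ff_inj _ _ genY _ h').
by rewrite barE -!(ff_map_sect surj_f genY h h') psi'E ff_frob_sect.
Qed.

End Extension.

Theorem mainTheorem1 (p : nat) (X Y : integralScheme)
  (varX : F_finite_variety p X) (varY : F_finite_variety p Y)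
  (normX : normal X) (normY : normal Y)
  (f : schemeMor Y X)
  (fin_f : finite_mor f) (surj_f : surjective_mor f)
  (sep_f : separable_mor f) (tame_f : tame_in_codim_one p f)
  (e : nat) (e_gt0 : (0 < e)%N)
  (psi : frobHom p e X) (psi_neq0 : frob_nonzero psi) :
  ((exists psibar : frobHom p e Y, extends f psibar psi) <->
     qdiv_le (Ram f) (qdiv_pullback f (Delta psi))) /\
  (forall psibar : frobHom p e Y, extends f psibar psi ->
     qdiv_eq (Delta psibar)
       (fun y => qdiv_pullback f (Delta psi) y - Ram f y)).
Proof.
have [eta genY] := ex_generic_pt Y.
have p_pr : prime p by case: varX => k [i [charp _ _]]; exact: pcharf_prime charp.
have c_gt0 : (0 < p ^ e - 1)%N.
  by rewrite subn_gt0 -(expn0 p) ltn_exp2l // prime_gt1.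
have DP := D_psi_extension varX varY fin_f surj_f sep_f tame_f psi_neq0 genY.
split; [split=> [[psibar ext] y codim_y|le_ram]|move=> psibar ext y codim_y].
- rewrite /Ram /qdiv_pullback /Delta ram_divisor_le ?(ram_index_gt0 tame_f) //.
  by rewrite subn1 -(DP psibar y ext codim_y) leq_addl.
- apply: (ex_extension varX varY normY fin_f surj_f sep_f tame_f psi_neq0 genY) => y codim_y.
  have := le_ram y codim_y.
  by rewrite /Ram /qdiv_pullback /Delta ram_divisor_le ?(ram_index_gt0 tame_f) // subn1.
- apply: ram_divisor_eq => //; first exact: (ram_index_gt0 tame_f).
  by rewrite subn1; exact: DP.
Qed.
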